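(* Let $\Omega\subset\mathbb{R}^n$ be measurable with $|\Omega|<\infty$. Let $1<p<q<\infty$, $\theta,\theta_0,\theta_1\geqslant 0$, $\frac1r=1+\frac1q-\frac1p$, and $0<\tau\leqslant\infty$. (i) If $\theta=\theta_1+\theta_0$, then for all measurable $f,g$ on $\Omega$ for which the right-hand sides are finite, $$\|f*g\|_{GL_{q,\tau}^{\theta_1}(\Omega)}\lesssim\|f\|_{GL_{p,\tau}^{-\theta_0}(\Omega)}\|g\|_{GL_{r,\infty}^{\theta}(\Omega)}$$ and $$\|f*g\|_{GL_{q,\tau}^{-\theta_1}(\Omega)}\lesssim\|f\|_{GL_{p,\tau}^{\theta_0}(\Omega)}\|g\|_{GL_{r,\infty}^{-\theta}(\Omega)}.$$ (ii) If $\theta=\theta_1-\theta_0$, then for all measurable $f,g$ on $\Omega$ for which the right-hand sides are finite, $$\|f*g\|_{GL_{q,\tau}^{\theta_1}(\Omega)}\lesssim\|f\|_{GL_{p,\tau}^{\theta_0}(\Omega)}\|g\|_{GL_{r,\infty}^{\theta}(\Omega)}$$ and $$\|f*g\|_{GL_{q,\tau}^{-\theta_1}(\Omega)}\lesssim\|f\|_{GL_{p,\tau}^{-\theta_0}(\Omega)}\|g\|_{GL_{r,\infty}^{-\theta}(\Omega)}.$$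
   Context: $f^*$ denotes the non-increasing rearrangement of a measurable function $f$ on $\Omega$. For $\theta\in\mathbb{R}$, $0<p<\infty$, $0<q\leqslant\infty$, the grand Lorentz space $GL_{p,q}^{\theta}(\Omega)$ is the set of measurable $f$ on $\Omega$ with finite $\|f\|_{GL_{p,q}^\theta(\Omega)}$, where for $\theta\geqslant 0$ $$\|f\|_{GL_{p,q}^\theta(\Omega)}=\sup_{0<\varepsilon<1}\varepsilon^{\theta}\left(\int_0^1\left(t^{\frac1p+\varepsilon}f^*(t|\Omega|)\right)^q\frac{dt}{t}\right)^{1/q},$$ and for $\theta<0$ $$\|f\|_{GL_{p,q}^\theta(\Omega)}=\inf_{0<\varepsilon<\frac1p}\varepsilon^{\theta}\left(\int_0^1\left(t^{\frac1p-\varepsilon}f^*(t|\Omega|)\right)^q\frac{dt}{t}\right)^{1/q};$$ when $q=\infty$ the expression $(\int_0^1(\cdot)^q\frac{dt}{t})^{1/q}$ is replaced by $\sup_{0<t<1}(\cdot)$. For $\theta=0$ this is the classical Lorentz space $L_{p,q}(\Omega)$ (with equivalent quasinorm). The convolution over $\Omega$ is $f*g(y)=\int_\Omega f(x)g(y-x)\,dx$, $y\in\Omega$, where $f,g$ are extended by zero outside $\Omega$. $A\lesssim B$ means $A\leqslant CB$ with a constant $C>0$ not depending on the functions $f,g$. *)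

(* Defs.v *)
From HB Require Import structures.
From mathcomp Require Import all_boot all_order all_algebra.
From mathcomp Require Import all_classical all_reals all_analysis.
From mathcomp Require Import measurable_realfun.
Set Implicit Arguments.
Unset Strict Implicit.
Unset Printing Implicit Defensive.
Import Order.TTheory GRing.Theory Num.Theory.
Import numFieldNormedType.Exports.
Local Open Scope classical_set_scope.
Local Open Scope ring_scope.
Local Open Scope ereal_scope.

(* Lebesgue measure on R^d, d >= 1, in the form d = n.+1: the outer measure
   obtained from countable covers by half-open boxes, restricted to its
   Caratheodory measurable sets, i.e. to the (complete) Lebesgue
   sigma-algebra. *)
Section lebesgue_measure_Rn.
Context {R : realType} {n : nat}.
Implicit Types (a b : 'rV[R]_n.+1) (A : set 'rV[R]_n.+1).

Definition box a b : set 'rV[R]_n.+1 :=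
  [set x | forall i, (a ord0 i < x ord0 i <= b ord0 i)%R].

Definition box_volume a b : R :=
  (\prod_i Num.max 0 (b ord0 i - a ord0 i))%R.

Definition box_cover A : set (nat -> 'rV[R]_n.+1 * 'rV[R]_n.+1) :=
  [set B | A `<=` \bigcup_k box (B k).1 (B k).2].

Definition lebesgue_outer A : \bar R :=
  ereal_inf [set \sum_(0 <= k <oo) (box_volume (B k).1 (B k).2)%:E |
              B in box_cover A].

Lemma box_volume_ge0 a b : (0 <= box_volume a b)%R.
Proof. by apply: prodr_ge0 => i _; rewrite le_max lexx. Qed.

Lemma lebesgue_outer_ge0 A : 0 <= lebesgue_outer A.
Proof.
apply: le_ereal_inf_tmp => _ [B _ <-].
by apply: nneseries_ge0 => k _ _; rewrite lee_fin box_volume_ge0.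
Qed.

Lemma lebesgue_outer0 : lebesgue_outer set0 = 0.
Proof.
apply/eqP; rewrite eq_le lebesgue_outer_ge0 andbT.
apply: ereal_inf_lbound; exists (fun=> (0%R, 0%R)) => //.
apply: eseries0 => k _ _ /=.
by rewrite /box_volume big_ord_recl !mxE subrr maxxx mul0r.
Qed.

Lemma le_lebesgue_outer : {homo lebesgue_outer : A B / A `<=` B >-> A <= B}.
Proof.
move=> A A' AA'; apply: ereal_inf_le_tmp => _ [B AB <-].
by exists B => //; exact: subset_trans AA' AB.
Qed.

Lemma lebesgue_outer_sigma_subadditive : sigma_subadditive lebesgue_outer.
Proof.
move=> A; have [[i ioo]|] := pselect (exists i, lebesgue_outer (A i) = +oo).
  rewrite (eseries_pinfty _ _ ioo) ?leey// => m _.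
  by rewrite -ltNye (lt_le_trans _ (lebesgue_outer_ge0 _)).
rewrite -forallNE => Aoo.
suff add2e (e : {posnum R}) : lebesgue_outer (\bigcup_m A m) <=
    \sum_(i <oo) lebesgue_outer (A i) + e%:num%:E.
  by apply/lee_addgt0Pr => _/posnumP[].
rewrite (le_trans _ (epsilon_trick _ _ _))//; last first.
  by move=> m; exact: lebesgue_outer_ge0.
pose v (c : 'rV[R]_n.+1 * 'rV[R]_n.+1) := (box_volume c.1 c.2)%:E.
have v_ge0 c : 0 <= v c by rewrite lee_fin box_volume_ge0.
pose P m B := box_cover (A m) B /\ \sum_(k <oo) v (B k) <=
  lebesgue_outer (A m) + (e%:num / (2 ^ m.+1)%:R)%:E.
have [G PG] : {G & forall m, P m (G m)}.
  apply: (@choice _ _ P) => m; rewrite /P /lebesgue_outer.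
  set S := (X in ereal_inf X); move infS : (ereal_inf S) => iS.
  case: iS infS => [r Sr|Soo|Soo].
  - have en1 : (0 < e%:num / (2 ^ m.+1)%:R)%R by [].
    have /(lb_ereal_inf_adherent en1) : ereal_inf S \is a fin_num by rewrite Sr.
    move=> [x [B AB vBx] xS].
    by exists B; split => //; rewrite vBx -Sr; exact/ltW.
  - by have := Aoo m; rewrite /lebesgue_outer Soo.
  - by have := lebesgue_outer_ge0 (A m); rewrite /lebesgue_outer Soo.
have vG_ge0 x : 0 <= (v \o uncurry G) x by exact: v_ge0.
apply: (@le_trans _ _ (\esum_(i in setT) (v \o uncurry G) i)).
  apply: ereal_inf_lbound => /=.
  have /card_esym/ppcard_eqP[f] := card_nat2.
  exists (uncurry G \o f).
    move=> t [i _ /((PG i).1 t)[j _ Gt]].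
    by exists (f^-1%FUN (i, j)) => //=; rewrite invK ?inE.
  rewrite -(esum_pred_image (v \o uncurry G) _ xpredT) ?[fun=> _]set_true//.
  by rewrite image_eq.
rewrite (_ : esum _ _ = \sum_(i <oo) \sum_(j <oo) v (G i j)); last first.
  pose J : nat -> set (nat * nat) := fun i => [set (i, j) | j in setT].
  rewrite (_ : setT = \bigcup_k J k); last first.
    by rewrite predeqE => -[a b]; split => // _; exists a => //; exists b.
  rewrite esum_bigcupT /=; last 2 first.
    - apply/trivIsetP => i j _ _ ij.
      rewrite predeqE => -[k m] /=; split => //= -[] [_] _ [<-{k} _].
      by move=> [m' _] [] /esym/eqP; rewrite (negbTE ij).
    - by move=> m; exact: v_ge0.
  rewrite -(image_id [set: nat]) -fun_true esum_pred_image//; last first.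
    by move=> m _; exact: esum_ge0.
  apply: eq_eseriesr => /= j _.
  rewrite -(esum_pred_image (v \o uncurry G) (pair j) predT)//=; last first.
    by move=> ? ? _ _; exact: (@can_inj _ _ _ snd).
  by congr esum; rewrite predeqE => -[a b]; split; move=> [i _ <-]; exists i.
apply: lee_lim.
- apply: is_cvg_nneseries => m *.
  by apply: nneseries_ge0 => k *; exact: (vG_ge0 (m, k)).
- apply: is_cvg_nneseries => m *.
  by apply: adde_ge0 => //; exact: lebesgue_outer_ge0.
- by near=> m; apply: lee_sum => i _; exact: (PG i).2.
Unshelve. all: by end_near. Qed.

HB.instance Definition _ := isOuterMeasure.Build R 'rV[R]_n.+1 lebesgue_outer
  lebesgue_outer0 lebesgue_outer_ge0 le_lebesgue_outer
  lebesgue_outer_sigma_subadditive.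

End lebesgue_measure_Rn.

(* R^n.+1 with its Lebesgue sigma-algebra. *)
Notation Rn R n := (caratheodory_type (@lebesgue_outer R n)).

Definition lebesgue_Rn (R : realType) (n : nat) : set (Rn R n) -> \bar R :=
  @lebesgue_outer R n.

HB.instance Definition _ (R : realType) (n : nat) :=
  isMeasure.Build _ _ _ (@lebesgue_Rn R n)
    (@caratheodory_measure0 R _ (@lebesgue_outer R n))
    (@caratheodory_measure_ge0 R _ (@lebesgue_outer R n))
    (@caratheodory_measure_sigma_additive R _ (@lebesgue_outer R n)).

Section grand_lorentz.
Context {R : realType} {n : nat}.
Local Notation mu := (@lebesgue_Rn R n).
Implicit Types (Omega : set (Rn R n)) (f g : Rn R n -> \bar R) (p theta : R)
  (q : \bar R).

Definition rearrangement Omega f (t : R) : \bar R :=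
  ereal_inf [set s%:E | s in
    [set s : R | (0 <= s)%R /\
      mu (Omega `&` [set x | s%:E < `|f x|]) <= t%:E]].

Definition lorentz_qnorm Omega (a : R) q f : \bar R :=
  let F t := (t `^ a)%:E * rearrangement Omega f (t * fine (mu Omega)) in
  match q with
  | q'%:E => (\int[lebesgue_measure]_(t in `]0%R, 1%R[)
                (F t `^ q' * (t^-1)%:E)) `^ q'^-1
  | +oo => ereal_sup [set F t | t in `]0%R, 1%R[]
  | -oo => 0 (* q > 0 is assumed *)
  end.

Definition GL_norm Omega theta p q f : \bar R :=
  if (0 <= theta)%R then
    ereal_sup [set (e `^ theta)%:E * lorentz_qnorm Omega (p^-1 + e) q f |
                e in `]0%R, 1%R[]
  else
    ereal_inf [set (e `^ theta)%:E * lorentz_qnorm Omega (p^-1 - e) q f |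
                e in `]0%R, p^-1%R[].

Definition grand_lorentz Omega theta p q : set (Rn R n -> \bar R) :=
  [set f |
    measurable_fun Omega f /\ GL_norm Omega theta p q f < +oo].

(* [g \_ Omega] is the extension of g by zero outside Omega; integrating over
   Omega accounts for the extension of f. *)
Definition convolution Omega f g (y : Rn R n) : \bar R :=
  \int[mu]_(x in Omega)
    (f x * (g \_ Omega) ((y : 'rV[R]_n.+1) - (x : 'rV[R]_n.+1))%R).

End grand_lorentz.

(* Main.v *)
Require Import Defs.
From HB Require Import structures.
From mathcomp Require Import all_boot all_order all_algebra.
From mathcomp Require Import all_classical all_reals all_analysis.
From mathcomp Require Import measurable_realfun.
From mathcomp Require Import lra ring.
Set Implicit Arguments.
Unset Strict Implicit.
Unset Printing Implicit Defensive.
Import Order.TTheory GRing.Theory Num.Theory.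
Import numFieldNormedType.Exports.
Local Open Scope classical_set_scope.
Local Open Scope ring_scope.
Local Open Scope ereal_scope.

(** Write [1/p], [1/r], [1/q] for the three critical exponents, so that
    [1/q = 1/p + 1/r - 1]. The heart of the matter is Young's inequality with a
    weak factor, for exponents near the critical ones:
    the convolution maps the Lorentz spaces with exponents [a] for [f]
    (second index [tau]) and [b] for [g] (second index [+oo]) to the one with
    exponent [a + b - 1] (second index [tau]), with a constant that is uniform as
    long as [a] and [b] stay below [1] and [a + b - 1] stays above [0]
    (lorentz_convolution_le). The grand quasinorms shift the critical exponents
    by small amounts and multiply by powers of these amounts, so what remains is
    to distribute the shift of the convolution between [f] and [g] and to compare
    the powers (grand_young_neg_pos and its three companions). Large shifts are irrelevant because
    the Lorentz quasinorms are monotone in the exponent. When an exponent [theta]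
    vanishes, the quasinorm with exponent [- theta] becomes a supremum; it is then
    compared with the classical Lorentz quasinorm, which corresponds to the
    shift [0] (lorentz_right_limit).

    Young's inequality is proved on dyadic samples of the rearrangements. Cutting
    [|f|] and [|g|] at the samples [f* (2^-j |Omega|)] and [g* (2^-k |Omega|)]
    reduces the convolution to overlaps [|A /\ (y - B)|] of a layer [A] of [f] with
    a reflected layer [B] of [g]. Such an overlap is at most [min (|A|, |B|)], and
    as a function of [y] it has an integral of order [|A| |B|]. The latter is
    Fubini's theorem for indicator functions; up to a constant it follows from
    covering [A] and [B] by boxes, for which it is an explicit computation
    (overlap_majorant), so no product measure appears. Both bounds together give
    a dyadic form of O'Neil's inequality (dyadic_convolution_le).
    With power weights it becomes a discrete convolution with a geometric kernel,
    which is bounded on [l^tau] for every [tau > 0] (discrete_hardy). *)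

(** * Boxes, half-spaces and reflections *)

Section euclidean_boxes.
Context {R : realType} {n : nat}.
Implicit Types (a b y : 'rV[R]_n.+1) (A B X : set 'rV[R]_n.+1).
Local Notation outer := (@lebesgue_outer R n).

Lemma box_volumexx a : box_volume a a = 0%R.
Proof. by rewrite /box_volume big_ord_recl subrr maxxx mul0r. Qed.

Lemma lebesgue_outer_box a b : outer (box a b) <= (box_volume a b)%:E.
Proof.
apply: ereal_inf_lbound.
exists (fun k => if k == 0%N then (a, b) else (a, a)).
  by move=> x abx; exists 0%N.
rewrite (nneseries_recl (P := xpredT)) //=; last first.
  by move=> k _; rewrite lee_fin box_volume_ge0.
rewrite eseries0 ?adde0// => -[|k]//= _ _.
by rewrite box_volumexx.
Qed.

Definition set_coord a (i : 'I_n.+1) (s : R) : 'rV[R]_n.+1 :=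
  \row_j (if j == i then s else a ord0 j).

Lemma box_half_space a b i s :
  box a b `&` [set x | (x ord0 i <= s)%R] =
  box a (set_coord b i (Num.min (b ord0 i) s)).
Proof.
apply/seteqP; split=> x /=.
  move=> [abx xs] j; rewrite mxE; case: eqP => [->|_]; last exact: abx.
  by rewrite le_min xs; have /andP[-> ->] := abx i.
move=> abx; split.
  move=> j; have := abx j; rewrite mxE; case: eqP => [->|//].
  by rewrite le_min => /and3P[-> ->].
by have := abx i; rewrite mxE eqxx le_min => /and3P[].
Qed.

Lemma box_half_spaceC a b i s :
  box a b `&` ~` [set x | (x ord0 i <= s)%R] =
  box (set_coord a i (Num.max (a ord0 i) s)) b.
Proof.
apply/seteqP; split=> x /=.
  move=> [abx /negP]; rewrite -ltNge => xs j.
  rewrite mxE; case: eqP => [->|_]; last exact: abx.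
  by rewrite gt_max xs; have /andP[-> ->] := abx i.
move=> abx; split.
  move=> j; have := abx j; rewrite mxE; case: eqP => [->|//].
  by rewrite gt_max => /andP[/andP[-> _] ->].
by have := abx i; rewrite mxE eqxx gt_max => /andP[/andP[_]]; rewrite ltNge => /negP.
Qed.

Lemma box_volume_half_space a b i s :
  (box_volume a (set_coord b i (Num.min (b ord0 i) s)) +
   box_volume (set_coord a i (Num.max (a ord0 i) s)) b = box_volume a b)%R.
Proof.
rewrite /box_volume (bigD1 i)//= [X in (_ + X)%R](bigD1 i)//= [RHS](bigD1 i)//=.
rewrite !mxE eqxx.
under eq_bigr => j /negbTE ji do rewrite mxE ji.
under [X in (_ + _ * X)%R]eq_bigr => j /negbTE ji do rewrite mxE ji.
rewrite -mulrDl; congr (_ * _)%R.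
move: (a ord0 i) (b ord0 i) => u v; rewrite /Num.max /Num.min.
by repeat case: ifPn; lra.
Qed.

(** A half-space cuts a box into two boxes whose volumes add up exactly, so a
    cover of [X] splits into covers of the two parts at no cost. *)
Lemma half_space_caratheodory i s :
  outer.-caratheodory [set x | (x ord0 i <= s)%R].
Proof.
apply: le_caratheodory_measurable => X.
apply: le_ereal_inf_tmp => _ [B XB <-].
pose H := [set x : 'rV[R]_n.+1 | (x ord0 i <= s)%R].
pose B1 k := ((B k).1, set_coord (B k).2 i (Num.min ((B k).2 ord0 i) s)).
pose B2 k := (set_coord (B k).1 i (Num.max ((B k).1 ord0 i) s), (B k).2).
have v0 (C : nat -> 'rV[R]_n.+1 * 'rV[R]_n.+1) k :
  0 <= (box_volume (C k).1 (C k).2)%:E by rewrite lee_fin box_volume_ge0.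
have -> : \sum_(0 <= k <oo) (box_volume (B k).1 (B k).2)%:E =
    \sum_(0 <= k <oo) (box_volume (B1 k).1 (B1 k).2)%:E +
    \sum_(0 <= k <oo) (box_volume (B2 k).1 (B2 k).2)%:E.
  rewrite -nneseriesD => [|k _ _|k _ _]; [|exact: v0|exact: v0].
  by apply: eq_eseriesr => k _; rewrite -EFinD box_volume_half_space.
apply: leeD; apply: ereal_inf_lbound.
- exists B1 => // x [/XB [k _ Bx] Hx]; exists k => //.
  by rewrite -box_half_space.
- exists B2 => // x [/XB [k _ Bx] Hx]; exists k => //.
  by rewrite -box_half_spaceC.
Qed.

Lemma measurable_box a b : measurable (box a b : set (Rn R n)).
Proof.
have -> : box a b = \bigcap_(i : 'I_n.+1) (~` [set x | (x ord0 i <= a ord0 i)%R]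
    `&` [set x | (x ord0 i <= b ord0 i)%R]).
  apply/seteqP; split=> x /= abx i.
    by move=> _; have /andP[axi xbi] := abx i; split=> //; apply/negP; rewrite -ltNge.
  by have [/negP] := abx i I; rewrite -ltNge => -> ->.
apply: fin_bigcap_measurable => // i _.
by apply: measurableI; [apply: measurableC|]; exact: half_space_caratheodory.
Qed.

(** Reflecting a half-open box gives a box closed on the wrong side, which is
    covered by a box whose widths are larger by the factor [rho ^ (-1/(n+1))].
    The volumes grow by the factor [rho^-1], uniformly over all boxes of a cover,
    and [rho < 1] is arbitrary. *)
Lemma lebesgue_outer_reflection_le y A :
  outer ((fun x => (y - x)%R) @^-1` A) <= outer A.
Proof.
apply/lee_mul01Pr; first exact: lebesgue_outer_ge0.
move=> rho /andP[rho0 rho1].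
apply: le_ereal_inf_tmp => _ [B AB <-].
pose s := (rho `^ n.+1%:R^-1)%R.
have s0 : (0 < s)%R by exact: powR_gt0.
have sX : (s ^+ n.+1 = rho)%R.
  by rewrite -powR_mulrn ?(ltW s0)// /s -powRrM mulVf ?powRr1 ?(ltW rho0).
have s1 : (s < 1)%R.
  by rewrite -[(s < 1)%R](@expr_lt1 _ n.+1 s) ?(ltW s0)// sX.
pose w k : 'rV[R]_n.+1 := \row_i Num.max 0%R ((B k).2 ord0 i - (B k).1 ord0 i)%R.
pose C k : 'rV[R]_n.+1 * 'rV[R]_n.+1 :=
  ((y - (B k).1 - s^-1 *: w k)%R, (y - (B k).1)%R).
have volC k : (box_volume (B k).1 (B k).2 = rho * box_volume (C k).1 (C k).2)%R.
  rewrite /box_volume -sX -[X in (s ^+ X)%R](card_ord n.+1) -prodr_const -big_split/=.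
  apply: eq_bigr => i _; rewrite !mxE subKr.
  rewrite [in RHS]max_r ?mulr_ge0 ?invr_ge0 ?(ltW s0) ?le_max ?lexx//.
  by rewrite mulVKf// gt_eqF.
have v0 k : 0 <= (box_volume (C k).1 (C k).2)%:E by rewrite lee_fin box_volume_ge0.
under eq_eseriesr => k _ do rewrite volC EFinM.
rewrite nneseriesZl; last by move=> k _.
rewrite lee_pmul2l ?lte_fin//.
apply: ereal_inf_lbound; exists C => // x /= /AB [k _ Bkx]; exists k => // i.
have /andP[] := Bkx i; rewrite !mxE /= => ax xb.
have lts : (w k ord0 i < s^-1 * w k ord0 i)%R.
  rewrite ltr_pMl ?invf_gt1// mxE lt_max; apply/orP; right; lra.
have : ((B k).2 ord0 i - (B k).1 ord0 i <= w k ord0 i)%R by rewrite mxE le_max lexx orbT.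
by move: lts; rewrite mxE => *; apply/andP; split; lra.
Qed.

Lemma lebesgue_outer_reflection y A :
  outer ((fun x => (y - x)%R) @^-1` A) = outer A.
Proof.
apply/eqP; rewrite eq_le lebesgue_outer_reflection_le/=.
have {1}-> : A = (fun x => (y - x)%R) @^-1` ((fun x => (y - x)%R) @^-1` A).
  by apply/seteqP; split=> x /=; rewrite subKr.
exact: lebesgue_outer_reflection_le.
Qed.

(** Caratheodory's criterion only mentions the outer measure, so it is
    transported by the reflection. *)
Lemma measurable_reflection (y : Rn R n) :
  measurable_fun setT (fun x : Rn R n => ((y : 'rV[R]_n.+1) - x)%R : Rn R n).
Proof.
move=> _ A mA; rewrite setTI.
have {}mA : outer.-caratheodory A := mA.
change (outer.-caratheodory ((fun x : 'rV[R]_n.+1 => (y - x)%R) @^-1` A)) => X.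
rewrite -(lebesgue_outer_reflection y X) [LHS]mA.
have K Z : (fun x => (y - x)%R) @^-1` (((fun x => (y - x)%R) @^-1` X) `&` Z) =
    X `&` ((fun x => (y - x)%R) @^-1` Z).
  by apply/seteqP; split=> x /=; rewrite subKr.
rewrite -(lebesgue_outer_reflection y (_ `&` A)) K.
by rewrite -(lebesgue_outer_reflection y (_ `&` ~` A)) K.
Qed.

End euclidean_boxes.

(** * Overlaps of a set with a reflected set *)

Section convolution_of_sets.
Context {R : realType} {n : nat}.
Implicit Types (a b : 'rV[R]_n.+1) (A B : set 'rV[R]_n.+1).
Local Notation outer := (@lebesgue_outer R n).
Local Notation mu := (@lebesgue_Rn R n).

Definition width a b (i : 'I_n.+1) : R := Num.max 0%R (b ord0 i - a ord0 i)%R.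

Lemma width_ge0 a b i : (0 <= width a b i)%R.
Proof. by rewrite /width le_max lexx. Qed.

Definition overlap_bound a b a' b' : R :=
  (\prod_i (2 * Num.min (width a b i) (width a' b' i)))%R.

Lemma overlap_bound_ge0 a b a' b' : (0 <= overlap_bound a b a' b')%R.
Proof. by apply: prodr_ge0 => i _; rewrite mulr_ge0// le_min !width_ge0. Qed.

(** In each direction the intersection is confined by the narrower of the two
    boxes. When that is the reflected one, it is closed on the wrong side; the
    factor 2 leaves room to cover it by a half-open interval. *)
Lemma outer_box_reflection a b a' b' (y : 'rV[R]_n.+1) :
  outer (box a b `&` (fun x => (y - x)%R) @^-1` box a' b') <=
  (overlap_bound a b a' b')%:E * (\1_(box (a + a')%R (b + b')%R) y)%:E.
Proof.
have [->|/set0P[x0 [x0ab x0ab']]] :=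
    eqVneq (box a b `&` (fun x => (y - x)%R) @^-1` box a' b') set0.
  rewrite lebesgue_outer0 mule_ge0 ?lee_fin ?overlap_bound_ge0//.
rewrite indicE mem_set ?mule1; last first.
  move=> i; have := x0ab i; have := x0ab' i; rewrite !mxE.
  by move=> /andP[? ?] /andP[? ?]; apply/andP; split; lra.
pose t i := (width a b i <= width a' b' i)%R.
pose l : 'rV[R]_n.+1 := \row_i (if t i then a ord0 i else
  y ord0 i - a' ord0 i - 2 * width a' b' i)%R.
pose u : 'rV[R]_n.+1 := \row_i (if t i then b ord0 i else y ord0 i - a' ord0 i)%R.
apply: (@le_trans _ _ (outer (box l u))).
  apply: le_lebesgue_outer => x [xab xab'] i; rewrite !mxE.
  have := xab i; have := xab' i; rewrite !mxE => /andP[h1 h2] h3.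
  case: ifPn => // _.
  have : (b' ord0 i - a' ord0 i <= width a' b' i)%R by rewrite /width le_max lexx orbT.
  by move: h1 h2 => *; apply/andP; split; lra.
apply: (le_trans (lebesgue_outer_box _ _)); rewrite lee_fin.
apply: ler_prod => i _; rewrite le_max lexx/= !mxE.
have w0 := width_ge0 a b i; have w0' := width_ge0 a' b' i.
case: ifPn => [ti|].
  by rewrite (min_l ti) -/(width _ _ _); lra.
rewrite /t -ltNge => /ltW ti; rewrite (min_r ti).
by rewrite ge_max; apply/andP; split; lra.
Qed.

Lemma overlap_bound_volume a b a' b' :
  (overlap_bound a b a' b' * box_volume (a + a') (b + b') <=
   4 ^+ n.+1 * (box_volume a b * box_volume a' b'))%R.
Proof.
rewrite /overlap_bound /box_volume -[X in (4 ^+ X)%R](card_ord n.+1) -prodr_const.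
rewrite -!big_split/=; apply: ler_prod => i _; rewrite !mxE.
rewrite mulr_ge0 ?mulr_ge0 ?le_min ?width_ge0// ?le_max ?lexx//=.
rewrite -/(width a b i) -/(width a' b' i).
have w0 := width_ge0 a b i; have w0' := width_ge0 a' b' i.
have wa : (b ord0 i - a ord0 i <= width a b i)%R by rewrite /width le_max lexx orbT.
have wa' : (b' ord0 i - a' ord0 i <= width a' b' i)%R by rewrite /width le_max lexx orbT.
have : (Num.max 0 (b ord0 i + b' ord0 i - (a ord0 i + a' ord0 i)) <=
   width a b i + width a' b' i)%R.
  by rewrite ge_max; apply/andP; split; lra.
move: (Num.max _ _) (width a b i) (width a' b' i) w0 w0' => m v v' v0 v0' mv.
rewrite /Num.min; case: ifPn => [|]; rewrite ?ltNge ?negbK => vv; nra.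
Qed.

(** Fubini for indicator functions, up to the constant [4 ^ (n+1)], and without
    any product measure: cover both sets by boxes; for two boxes the overlap is
    at most the product of the smaller widths (up to factors 2), and it vanishes
    for [y] outside a box whose widths are at most twice the larger ones. *)
Lemma overlap_majorant A B (al be : R) : outer A < al%:E -> outer B < be%:E ->
  exists psi : Rn R n -> \bar R, [/\ measurable_fun setT psi,
    forall y, 0 <= psi y,
    forall y : 'rV[R]_n.+1, outer (A `&` (fun x => (y - x)%R) @^-1` B) <= psi y &
    \int[mu]_y psi y <= (4 ^+ n.+1 * (al * be))%:E].
Proof.
move=> /ereal_inf_lt[_ [P AP <-] Pal] /ereal_inf_lt[_ [Q BQ <-] Qbe].
pose k u v := overlap_bound (P u).1 (P u).2 (Q v).1 (Q v).2.
pose S u v := box ((P u).1 + (Q v).1)%R ((P u).2 + (Q v).2)%R.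
pose F u v (y : Rn R n) := (k u v)%:E * (\1_(S u v) y)%:E.
have F0 u v y : 0 <= F u v y.
  by rewrite mule_ge0 ?lee_fin ?overlap_bound_ge0.
have mF u v : measurable_fun setT (F u v).
  apply: emeasurable_funM => //; apply/measurable_EFinP.
  exact: measurable_indic (measurable_box _ _).
have mFs u : measurable_fun setT (fun y => \sum_(v <oo) F u v y).
  by apply: ge0_emeasurable_sum.
have Fs0 u y : 0 <= \sum_(v <oo) F u v y by apply: nneseries_ge0.
pose vP u := (box_volume (P u).1 (P u).2)%:E.
pose vQ u := (box_volume (Q u).1 (Q u).2)%:E.
have vP0 u : 0 <= vP u by rewrite lee_fin box_volume_ge0.
have vQ0 u : 0 <= vQ u by rewrite lee_fin box_volume_ge0.
exists (fun y => \sum_(u <oo) \sum_(v <oo) F u v y); split.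
- by apply: ge0_emeasurable_sum.
- by move=> y; apply: nneseries_ge0.
- move=> y.
  pose D u v := box (P u).1 (P u).2 `&` (fun x => (y - x)%R) @^-1` box (Q v).1 (Q v).2.
  apply: (@le_trans _ _ (outer (\bigcup_u \bigcup_v D u v))).
    apply: le_lebesgue_outer => x [/AP[u _ Pu] /BQ[v _ Qv]].
    by exists u => //; exists v.
  apply: (le_trans (lebesgue_outer_sigma_subadditive _)).
  apply: lee_nneseries => [u _ _|u _]; first exact: lebesgue_outer_ge0.
  apply: (le_trans (lebesgue_outer_sigma_subadditive _)).
  apply: lee_nneseries => [v _ _|v _]; first exact: lebesgue_outer_ge0.
  exact: outer_box_reflection.
rewrite integral_nneseries//.
apply: (@le_trans _ _ (\sum_(u <oo) ((4 ^+ n.+1)%:E * \sum_(v <oo) vQ v) * vP u)).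
  apply: lee_nneseries => [u _ _|u _]; first by apply: integral_ge0.
  rewrite integral_nneseries//.
  have -> : ((4 ^+ n.+1)%:E * \sum_(v <oo) vQ v) * vP u =
      \sum_(v <oo) (4 ^+ n.+1 * box_volume (P u).1 (P u).2)%:E * vQ v.
    by rewrite nneseriesZl// EFinM muleAC.
  apply: lee_nneseries => [v _ _|v _]; first by apply: integral_ge0.
  rewrite /F ge0_integralZl_EFin//; last 2 first.
  - by apply/measurable_EFinP; exact: measurable_indic (measurable_box _ _).
  - exact: overlap_bound_ge0.
  rewrite integral_indic// ?setIT; last exact: measurable_box.
  apply: (@le_trans _ _ ((k u v)%:E * (box_volume ((P u).1 + (Q v).1) ((P u).2 + (Q v).2))%:E)).
    rewrite lee_wpmul2l ?lee_fin ?overlap_bound_ge0//.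
    exact: lebesgue_outer_box.
  by rewrite -!EFinM lee_fin -mulrA; exact: overlap_bound_volume.
have fin (x : \bar R) (z : R) : 0 <= x -> x < z%:E -> x = (fine x)%:E.
  by move=> x0 xz; rewrite fineK// ge0_fin_numE// (lt_trans xz)// ltry.
have Q0 : 0 <= \sum_(v <oo) vQ v by apply: nneseries_ge0.
have P0 : 0 <= \sum_(v <oo) vP v by apply: nneseries_ge0.
have EP := fin _ _ P0 Pal; have EQ := fin _ _ Q0 Qbe.
have Pf := Pal; have Qf := Qbe; rewrite -/vP EP lte_fin in Pf.
rewrite -/vQ EQ lte_fin in Qf.
rewrite EQ -EFinM nneseriesZl// EP -EFinM lee_fin.
by rewrite -mulrA ler_wpM2l// mulrC ler_pM ?fine_ge0// ltW.
Qed.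

End convolution_of_sets.

(** * Series and a discrete Hardy inequality *)

Section nonnegative_series.
Context {R : realType}.
Implicit Types (s tau : R) (x : nat -> \bar R).

Lemma le_nneseries_term (u : nat -> \bar R) k :
  (forall i, 0 <= u i) -> u k <= \sum_(i <oo) u i.
Proof.
move=> u0; rewrite (@nneseriesD1 _ u k xpredT)//.
by rewrite leeDl// nneseries_ge0.
Qed.

Lemma nneseries_le_partial (u : nat -> \bar R) (X : \bar R) :
  (forall i, 0 <= u i) -> (forall n, \sum_(0 <= i < n) u i <= X) ->
  \sum_(i <oo) u i <= X.
Proof.
move=> u0 uX; apply: lime_le; first by apply: is_cvg_nneseries.
exact: nearW.
Qed.

Lemma nneseries_geometric s : (0 <= s < 1)%R ->
  \sum_(i <oo) (s ^+ i)%:E = ((1 - s)^-1)%:E.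
Proof.
move=> /andP[s0 s1]; apply/cvg_lim => //.
rewrite (_ : (fun _ => _) = EFin \o series (geometric 1%R s)); last first.
  apply/funext => k; rewrite /= /series/= -sumEFin.
  by apply: eq_bigr => i _; rewrite mul1r.
apply: cvg_EFin; first exact: nearW.
by rewrite -[X in _ --> X]mul1r; apply: cvg_geometric_series; rewrite ger0_norm.
Qed.

(** [X] may be [+oo], which is why the constant [K] is required to be positive. *)
Lemma nneseriesZr_le (c : nat -> R) (X : \bar R) (K : R) :
  (forall i, 0 <= c i)%R -> (0 < K)%R -> 0 <= X ->
  \sum_(i <oo) (c i)%:E <= K%:E -> \sum_(i <oo) ((c i)%:E * X) <= K%:E * X.
Proof.
move=> c0 K0; case: X => [X| |]//; last by rewrite gt0_muley ?leey.
rewrite lee_fin => X0 cK; under eq_eseriesr => i _ do rewrite muleC.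
rewrite nneseriesZl => [|i _]; last by rewrite lee_fin.
by rewrite muleC lee_wpmul2r.
Qed.

Definition natdist (i j : nat) : nat := (i - j + (j - i))%N.

Lemma natdistC i j : natdist i j = natdist j i. Proof. exact: addnC. Qed.

Lemma nneseries_geometric_dist s (m : nat) : (0 < s < 1)%R ->
  \sum_(j <oo) (s ^+ natdist j m)%:E <= (2 / (1 - s))%:E.
Proof.
move=> /andP[s0 s1].
have G := @nneseries_geometric s.
rewrite (ltW s0) s1 in G; move/(_ isT) in G.
rewrite (nneseries_split _ m) => [|k _]; last by rewrite lee_fin exprn_ge0// ltW.
rewrite add0n mulr_natl mulr2n EFinD leeD//.
  rewrite -G; apply: (@le_trans _ _ (\sum_(0 <= i < m) (s ^+ i)%:E)); last first.
    by apply: nneseries_lim_ge => k _ _; rewrite lee_fin exprn_ge0// ltW.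
  rewrite [leRHS]big_nat_rev/= add0n !sumEFin lee_fin.
  apply: ler_sum_nat => i /andP[_ im]; rewrite /natdist.
  rewrite (eqP (ltnW im : i - m == 0)%N) add0n ler_wiXn2l ?(ltW s0) ?(ltW s1)//.
  by rewrite leq_sub2l.
rewrite -nneseries_addn => [|i]; last by rewrite lee_fin exprn_ge0// ltW.
rewrite -G; apply: lee_nneseries => [i _ _|i _].
  by rewrite lee_fin exprn_ge0// ltW.
by rewrite /natdist addnK subnDA subnAC subnn sub0n addn0.
Qed.

Lemma ge0_lee_poweR (r : R) (x y : \bar R) : (0 <= r)%R -> 0 <= x -> x <= y ->
  x `^ r <= y `^ r.
Proof.
move=> r0 x0 xy; apply: gt0_ler_poweR; rewrite ?in_itv/= ?leey ?andbT//.
exact: le_trans xy.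
Qed.

Lemma poweRK (r : R) (x : \bar R) : (0 < r)%R -> 0 <= x -> (x `^ r) `^ r^-1 = x.
Proof. by move=> r0 x0; rewrite -poweRrM mulfV ?gt_eqF// poweRe1. Qed.

Lemma poweRKV (r : R) (x : \bar R) : (0 < r)%R -> 0 <= x -> (x `^ r^-1) `^ r = x.
Proof. by move=> r0 x0; rewrite -poweRrM mulVf ?gt_eqF// poweRe1. Qed.

(** Splitting the weight [s ^ 2|j-m|] in two equal factors bounds the inner sum
    by a geometric series times the largest [s ^ |j-m| x_j], and the [tau]-th
    power of that maximum by a sum; so no case distinction at [tau = 1] is
    needed. *)
Lemma discrete_hardy s tau : (0 < s < 1)%R -> (0 < tau)%R ->
  exists2 C : R, (0 < C)%R & forall x, (forall j, 0 <= x j) ->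
    \sum_(m <oo) (\sum_(j <oo) ((s ^+ 2) ^+ natdist j m)%:E * x j) `^ tau <=
    C%:E * \sum_(j <oo) (x j `^ tau).
Proof.
move=> /andP[s0 s1] tau0.
pose K := (2 / (1 - s))%R.
have K0 : (0 < K)%R by rewrite divr_gt0// subr_gt0.
pose st := (s `^ tau)%R.
have st0 : (0 < st)%R by exact: powR_gt0.
have st1 : (st < 1)%R.
  have : (s `^ tau < 1 `^ tau)%R by apply: gt0_ltr_powR; rewrite ?nnegrE// ltW.
  by rewrite powR1.
pose K' := (2 / (1 - st))%R.
have K'0 : (0 < K')%R by rewrite divr_gt0// subr_gt0.
exists (K `^ tau * K')%R; first by rewrite mulr_gt0// powR_gt0.
move=> x x0.
have w0 j m : (0 <= s ^+ natdist j m)%R by rewrite exprn_ge0// ltW.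
pose z j m := (st ^+ natdist j m)%:E * x j `^ tau.
have zE j m : ((s ^+ natdist j m)%:E * x j) `^ tau = z j m.
  rewrite poweRM ?lee_fin// /z poweR_EFin; congr (_%:E * _).
  rewrite -(powR_mulrn _ (ltW s0)) -(powR_mulrn _ (ltW st0)).
  by rewrite /st -2!powRrM mulrC.
have z0 j m : 0 <= z j m by rewrite -zE poweR_ge0.
apply: (@le_trans _ _ (\sum_(m <oo) (K `^ tau)%:E * \sum_(j <oo) z j m)).
  apply: lee_nneseries => [m _ _|m _]; first exact: poweR_ge0.
  set Z := \sum_(j <oo) z j m.
  have Z0 : 0 <= Z by apply: nneseries_ge0 => j _ _; exact: z0.
  rewrite -[X in _ <= _ * X](poweRKV tau0 Z0) -poweR_EFin -poweRM ?poweR_ge0//; last first.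
    by rewrite lee_fin ltW.
  apply: ge0_lee_poweR; first exact: ltW.
    by apply: nneseries_ge0 => j _ _; rewrite mule_ge0// lee_fin exprn_ge0// sqr_ge0.
  apply: (@le_trans _ _ (\sum_(j <oo) (s ^+ natdist j m)%:E * Z `^ tau^-1)).
    apply: lee_nneseries => [j _ _|j _].
      by rewrite mule_ge0// lee_fin exprn_ge0// sqr_ge0.
    rewrite expr2 exprMn EFinM -muleA lee_wpmul2l ?lee_fin//.
    rewrite -[leLHS](@poweRK tau)//; last by rewrite mule_ge0 ?lee_fin.
    apply: ge0_lee_poweR; [by rewrite invr_ge0 ltW|exact: poweR_ge0|].
    by rewrite zE; apply: (@le_nneseries_term (fun j => z j m)).
  apply: nneseriesZr_le => //; first exact: poweR_ge0.
  by apply: nneseries_geometric_dist; rewrite s0.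
rewrite nneseriesZl; last by move=> m _; apply: nneseries_ge0.
rewrite nneseries_interchange; last by move=> i j; exact: z0.
rewrite EFinM -muleA lee_wpmul2l ?lee_fin ?powR_ge0//.
rewrite -nneseriesZl; last by move=> j _; exact: poweR_ge0.
apply: lee_nneseries => [j _ _|j _]; first by apply: nneseries_ge0.
apply: nneseriesZr_le => //.
- by move=> m; rewrite exprn_ge0// ltW.
- exact: poweR_ge0.
under eq_eseriesr => m _ do rewrite natdistC.
by apply: nneseries_geometric_dist; rewrite st0.
Qed.

End nonnegative_series.

(** * Layers of the rearrangement and convolution *)

Section rearrangement_layers.
Context {R : realType} {n : nat} (Omega : set (Rn R n)).
Local Notation mu := (@lebesgue_Rn R n).
Implicit Types (u f g : Rn R n -> \bar R).

Lemma le_lebesgue_Rn (A B : set (Rn R n)) : A `<=` B -> mu A <= mu B.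
Proof. exact: le_lebesgue_outer. Qed.

Lemma rearrangement_ge0 u t : 0 <= rearrangement Omega u t.
Proof. by apply: le_ereal_inf_tmp => _ [s [s0 _] <-]; rewrite lee_fin. Qed.

Lemma rearrangement_anti u s t : (s <= t)%R ->
  rearrangement Omega u t <= rearrangement Omega u s.
Proof.
move=> st; apply: ereal_inf_le_tmp => _ [x [x0 xs] <-]; exists x => //; split => //.
by apply: (le_trans xs); rewrite lee_fin.
Qed.

Lemma rearrangement_total u t : mu Omega <= t%:E -> rearrangement Omega u t = 0.
Proof.
move=> Ot; apply/eqP; rewrite eq_le rearrangement_ge0 andbT.
apply: ereal_inf_lbound; exists 0%R => //; split => //.
by apply: le_trans Ot; apply: le_lebesgue_Rn; exact: subIsetl.
Qed.

Lemma measurable_level u (y : \bar R) : measurable Omega ->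
  measurable_fun Omega u -> measurable (Omega `&` [set x | y < `|u x|]).
Proof.
move=> mO mu_; apply: emeasurable_fun_o_infty => //.
exact: measurableT_comp.
Qed.

(** The infimum defining the rearrangement is attained: the level set above it is
    an increasing union of level sets of measure at most [t]. *)
Lemma rearrangement_level u t : measurable Omega -> measurable_fun Omega u ->
  (0 <= t)%R ->
  mu (Omega `&` [set x | rearrangement Omega u t < `|u x|]) <= t%:E.
Proof.
move=> mO mu_ t0; have := rearrangement_ge0 u t.
case E : (rearrangement Omega u t) => [r| |]// r0; last first.
  rewrite (_ : _ `&` _ = set0) ?measure0 ?lee_fin//.
  by apply/seteqP; split=> x //= []; rewrite ltNge leey.
pose L k := Omega `&` [set x | (r + k.+1%:R^-1)%:E < `|u x|].
have mL k : measurable (L k) by exact: measurable_level.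
have Lt k : mu (L k) <= t%:E.
  have : rearrangement Omega u t < (r + k.+1%:R^-1)%:E.
    by rewrite E lte_fin ltrDl invr_gt0.
  move=> /ereal_inf_lt[_ [s [s0 st] <-] sr]; apply: le_trans st.
  by apply: le_lebesgue_Rn => x [Ox]; split => //; exact: lt_trans sr _.
have -> : Omega `&` [set x | r%:E < `|u x|] = \bigcup_k L k.
  apply/seteqP; split=> [x [Ox /= rx]|x [k _ [Ox /= rx]]].
    have [k rk] : exists k, (r + k.+1%:R^-1)%:E < `|u x|.
      case: (`|u x|) rx => [z| |]//; last by exists 0%N; rewrite ltry.
      rewrite lte_fin -subr_gt0 => rz.
      have [k _ /(_ _ (leqnn k))] := near_infty_natSinv_lt (PosNum rz).
        by move=> h; exists k; rewrite lte_fin -ltrBrDl; exact: h.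
    by exists k.
  split => //=; apply: lt_trans rx; rewrite lte_fin ltrDl invr_gt0//.
have ndL : {homo L : i j / (i <= j)%N >-> (i <= j)%O}.
  move=> i j ij; apply/subsetPset => x [Ox /= rx]; split => //=.
  by apply: le_lt_trans rx; rewrite lee_fin lerD2l lef_pV2 ?posrE// ler_nat.
have cL := nondecreasing_cvg_mu (mu := mu) mL (bigcup_measurable (fun k _ => mL k)) ndL.
rewrite -(cvg_lim _ cL)//; apply: lime_le; first by apply/cvg_ex; eexists; exact: cL.
exact: nearW.
Qed.

(** All estimates below only use the rearrangement at the points
    [2^-k |Omega|]; the sample with [k = 0] vanishes. *)
Definition dyadic u (k : nat) : \bar R :=
  rearrangement Omega u (2^-1 ^+ k * fine (mu Omega)).

Definition layer u (k : nat) : set (Rn R n) :=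
  Omega `&` [set x | dyadic u k < `|u x|].

Lemma dyadic_ge0 u k : 0 <= dyadic u k.
Proof. exact: rearrangement_ge0. Qed.

Lemma dyadic_nd u i j : (i <= j)%N -> dyadic u i <= dyadic u j.
Proof.
move=> ij; apply: rearrangement_anti; rewrite ler_wpM2r ?fine_ge0//.
by rewrite ler_wiXn2l// invf_le1// ler1n.
Qed.

Lemma layer_anti u i j : (i <= j)%N -> layer u j `<=` layer u i.
Proof.
by move=> ij x [Ox /= jx]; split => //=; apply: le_lt_trans jx; exact: dyadic_nd.
Qed.

Hypothesis mOmega : measurable Omega.
Hypothesis Omega_fin : mu Omega < +oo.

Let M := fine (mu Omega).

Let muE : mu Omega = M%:E.
Proof. by rewrite /M fineK// ge0_fin_numE. Qed.

Lemma dyadic0 u : dyadic u 0 = 0.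
Proof. by apply: rearrangement_total; rewrite expr0 mul1r -/M -muE. Qed.

Let M_ge0 : (0 <= M)%R.
Proof. by rewrite -lee_fin -muE. Qed.

Lemma measurable_layer u k : measurable_fun Omega u -> measurable (layer u k).
Proof. by move=> mu_; exact: measurable_level. Qed.

Lemma layer_measure u k : measurable_fun Omega u ->
  mu (layer u k) <= (2^-1 ^+ k * M)%:E.
Proof.
by move=> mu_; apply: rearrangement_level => //; rewrite mulr_ge0// exprn_ge0.
Qed.

(** The layers decrease to a null set, so almost every point of the layer [m]
    leaves them at some first index. *)
Lemma layer_decomposition u m : measurable_fun Omega u ->
  {ae mu, forall x, `|(u \_ Omega) x| <= dyadic u m \/
    exists2 i, layer u (m + i) x & `|u x| <= dyadic u (m + i).+1}.
Proof.
move=> mu_; exists (\bigcap_k layer u k); split.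
- by apply: bigcap_measurable => // k _; exact: measurable_layer.
- apply/eqP; rewrite eq_le; apply/andP; split; last exact: lebesgue_outer_ge0.
  have cM : (2^-1 ^+ k * M)%:E @[k --> \oo] --> 0.
    apply: cvg_EFin; first exact: nearW.
    rewrite -[X in _ --> X](mul0r M); apply: cvgMl.
    have := @cvg_geometric R 1 2^-1; rewrite /geometric/=.
    under eq_fun do rewrite mul1r.
    by apply; rewrite ger0_norm// invf_lt1// ltr1n.
  rewrite -(cvg_lim _ cM)//; apply: lime_ge; first by apply/cvg_ex; eexists; exact: cM.
  apply: nearW => k; apply: le_trans (layer_measure k mu_).
  by apply: le_lebesgue_Rn; exact: bigcap_inf.
- move=> x /= ndec k _; apply: contrapT => nk; apply: ndec.
  rewrite patchE; case: ifPn => [|_]; last by rewrite abse0; left; exact: dyadic_ge0.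
  rewrite inE => Ox.
  have ex : exists i, x \notin layer u (m + i).
    exists k; rewrite notin_setE; apply: contra_not nk.
    by apply: layer_anti; rewrite leq_addl.
  case: (ex_minnP ex) => -[|i] + imin.
    rewrite addn0 notin_setE => h; left; rewrite leNgt; apply/negP => h'.
    by apply: h.
  rewrite notin_setE addnS => h; right; exists i.
    rewrite -[layer _ _ _]in_setE; apply: contrapT => /negP/imin.
    by rewrite ltnn.
  by rewrite leNgt; apply/negP => h'; apply: h.
Qed.

Lemma lebesgue_Rn_reflection (y : Rn R n) (A : set (Rn R n)) :
  mu ((fun x : Rn R n => ((y : 'rV[R]_n.+1) - x)%R : Rn R n) @^-1` A) = mu A.
Proof. exact: lebesgue_outer_reflection. Qed.

Lemma ae_reflection (y : Rn R n) (P : Rn R n -> Prop) :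
  {ae mu, forall x, P x} ->
  {ae mu, forall x : Rn R n, P ((y : 'rV[R]_n.+1) - x)%R}.
Proof.
move=> [N [mN N0 PN]].
exists ((fun x : Rn R n => ((y : 'rV[R]_n.+1) - x)%R : Rn R n) @^-1` N); split.
- by rewrite -[X in measurable X]setTI; exact: measurable_reflection.
- by rewrite lebesgue_Rn_reflection.
- by move=> x /= nP; exact: PN.
Qed.

Lemma measurable_fun_extension_reflection g (y : Rn R n) (D : set (Rn R n)) :
  measurable_fun Omega g ->
  measurable_fun D
    (fun x : Rn R n => (g \_ Omega) ((y : 'rV[R]_n.+1) - x)%R).
Proof.
move=> mg; apply: measurable_funTS.
apply: (measurableT_comp (f := g \_ Omega)); last exact: measurable_reflection.
exact: (measurable_restrictT g mOmega).1 mg.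
Qed.

(** The layers are nested and not disjoint; the resulting overcounting is harmless
    since only an upper bound is needed. *)
Lemma integral_reflection_layers g (y : Rn R n) (A : set (Rn R n)) m :
  measurable_fun Omega g -> measurable A ->
  \int[mu]_(x in A) `|(g \_ Omega) ((y : 'rV[R]_n.+1) - x)%R| <=
  dyadic g m * mu A + \sum_(i <oo) dyadic g (m + i).+1 *
    mu (A `&` (fun x : Rn R n => ((y : 'rV[R]_n.+1) - x)%R : Rn R n) @^-1`
          layer g (m + i)).
Proof.
move=> mg mA.
pose B i := (fun x : Rn R n => ((y : 'rV[R]_n.+1) - x)%R : Rn R n) @^-1`
          layer g (m + i).
have mB i : measurable (B i).
  rewrite -[X in measurable X]setTI.
  by apply: measurable_reflection => //; exact: measurable_layer.
have m1 i : measurable_fun A (fun x : Rn R n => (\1_(B i) x)%:E : \bar R).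
  by apply/measurable_EFinP; exact: measurable_indic.
pose F i (x : Rn R n) := dyadic g (m + i).+1 * (\1_(B i) x)%:E.
have F0 i x : 0 <= F i x by rewrite mule_ge0 ?dyadic_ge0 ?lee_fin.
have mF i : measurable_fun A (F i) by apply: emeasurable_funM.
have sF0 x : 0 <= \sum_(i <oo) F i x by apply: nneseries_ge0.
have msF : measurable_fun A (fun x => \sum_(i <oo) F i x).
  by apply: ge0_emeasurable_sum.
have -> : \sum_(i <oo) dyadic g (m + i).+1 * mu (A `&` B i) =
    \int[mu]_(x in A) \sum_(i <oo) F i x.
  rewrite integral_nneseries//; apply: eq_eseriesr => i _.
  rewrite ge0_integralZl ?dyadic_ge0//.
  by rewrite integral_indic// setIC.
rewrite -integral_cst// -ge0_integralD//; last by move=> x _; exact: dyadic_ge0.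
apply: ae_ge0_le_integral.
- exact: mA.
- by move=> x _; exact: abse_ge0.
- apply: measurableT_comp; first exact: abse_measurable.
  exact: measurable_fun_extension_reflection.
- by move=> x _; apply: adde_ge0; [exact: dyadic_ge0|exact: sF0].
- by apply: emeasurable_funD; [exact: measurable_cst|exact: msF].
have := ae_reflection y (layer_decomposition m mg).
apply: filterS => x /= [gx|[i ix gx]] Ax.
  by apply: (le_trans gx); rewrite leeDl.
have -> : (g \_ Omega) ((y : 'rV[R]_n.+1) - x)%R = g ((y : 'rV[R]_n.+1) - x)%R.
  by rewrite patchE ifT// inE; case: ix.
apply: (le_trans gx); apply: lee_paddl; first exact: dyadic_ge0.
apply: le_trans (le_nneseries_term i (fun i => F0 i x)).
by rewrite /F indicE mem_set// mule1.
Qed.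

Lemma convolution_layers f g (y : Rn R n) :
  measurable_fun Omega f -> measurable_fun Omega g ->
  `|convolution Omega f g y| <= \sum_(j <oo) dyadic f j.+1 *
    \int[mu]_(x in layer f j) `|(g \_ Omega) ((y : 'rV[R]_n.+1) - x)%R|.
Proof.
move=> mf mg.
have mG D := measurable_fun_extension_reflection y (D := D) mg.
have mfg : measurable_fun Omega
    (fun x : Rn R n => f x * (g \_ Omega) ((y : 'rV[R]_n.+1) - x)%R).
  exact: emeasurable_funM.
apply: (le_trans (le_abse_integral _ mOmega mfg)).
pose G (x : Rn R n) := `|(g \_ Omega) ((y : 'rV[R]_n.+1) - x)%R|.
pose F j (x : Rn R n) := dyadic f j.+1 * (G \_ (layer f j)) x.
have mGn D : measurable_fun D G by apply: measurableT_comp.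
have mGj j : measurable_fun Omega (G \_ (layer f j)).
  by apply/measurable_restrict => //; exact: measurable_layer.
have G0 j x : 0 <= (G \_ (layer f j)) x by rewrite patchE; case: ifP; rewrite ?abse_ge0.
have F0 j x : 0 <= F j x by rewrite mule_ge0 ?dyadic_ge0.
have mF j : measurable_fun Omega (F j) by apply: emeasurable_funM.
have sF0 x : 0 <= \sum_(i <oo) F i x by apply: nneseries_ge0.
have -> : \sum_(j <oo) dyadic f j.+1 * \int[mu]_(x in layer f j) G x =
    \int[mu]_(x in Omega) \sum_(i <oo) F i x.
  rewrite integral_nneseries//; apply: eq_eseriesr => j _.
  rewrite ge0_integralZl ?dyadic_ge0// -integral_mkcondr.
  by rewrite (setIidr (@subIsetl _ _ _)).
apply: ae_ge0_le_integral.
- exact: mOmega.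
- by move=> x _; exact: abse_ge0.
- by apply: measurableT_comp; [exact: abse_measurable|exact: mfg].
- by move=> x _; exact: sF0.
- exact: ge0_emeasurable_sum.
have := layer_decomposition 0 mf.
apply: filterS => x /= + Ox; rewrite dyadic0 patchE mem_set// => -[f0|[j jx fx]].
  rewrite abseM (_ : `|f x| = 0) ?mul0e//.
  by apply/eqP; rewrite eq_le f0 abse_ge0.
rewrite add0n in jx fx.
apply: le_trans (le_nneseries_term j (fun i => F0 i x)).
by rewrite /F patchE mem_set// abseM lee_wpmul2r.
Qed.

(** Chebyshev's inequality is applied to a majorant because a convolution such as
    [h] is not known to be measurable. *)
Lemma rearrangement_le_chebyshev (h T : Rn R n -> \bar R) (s s' t : R) :
  (0 <= s)%R -> (0 <= s')%R -> (0 < t)%R ->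
  measurable_fun setT T -> (forall y, 0 <= T y) ->
  (forall y, `|h y| <= s%:E + T y) ->
  \int[mu]_y T y <= (t * s')%:E ->
  rearrangement Omega h t <= (s + s')%:E.
Proof.
move=> s0 s'0 t0 mT T0 hT iT; apply/lee_addgt0Pr => e e0.
rewrite -EFinD; apply: ereal_inf_lbound; exists (s + s' + e)%R => //; split.
  by rewrite !addr_ge0// ltW.
have se0 : (0 < s' + e)%R by rewrite ltr_wpDl.
apply: (@le_trans _ _ (mu (setT `&` [set y | (s' + e)%:E <= `|T y|]))).
  apply: le_lebesgue_Rn => y [_ /= hy]; split => //=.
  rewrite gee0_abs// leNgt; apply/negP => Ty.
  have := lt_le_trans hy (hT y); rewrite ltNge => /negP; apply.
  by rewrite -addrA EFinD leeD2l// ltW.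
have := le_integral_comp_abse mu measurableT (f := id)
  (@measurable_id _ _ _) (fun _ => id) (fun _ _ _ _ => id) mT se0.
under eq_integral => y _ do rewrite gee0_abs//.
move=> /le_trans/(_ iT); rewrite -lee_pdivlMl// => /le_trans; apply.
by rewrite lee_fin ler_pdivrMl// mulrC ler_pM2r// lerDl ltW.
Qed.

End rearrangement_layers.

(** * O'Neil's inequality on dyadic samples *)

Section dyadic_oneil.
Context {R : realType} {n : nat} (Omega : set (Rn R n)).
Local Notation mu := (@lebesgue_Rn R n).
Implicit Types (f g : Rn R n -> \bar R).
Hypothesis mOmega : measurable Omega.
Hypothesis Omega_fin : mu Omega < +oo.
Local Notation M := (fine (mu Omega)).
Local Notation dyadic := (dyadic Omega).
Local Notation layer := (layer Omega).

Let half0 k : (0 <= 2^-1 ^+ k :> R)%R. Proof. by rewrite exprn_ge0. Qed.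

Let nneseries_ratio (be b1 : R) (c : R) : (0 < be <= b1)%R -> (b1 < 2)%R ->
  (0 <= c)%R ->
  \sum_(i <oo) (c * (be * (be / 2) ^+ i))%:E <= (c * (b1 / (1 - b1 / 2)))%:E.
Proof.
move=> /andP[b0 bb1] b12 c0.
under eq_eseriesr => i _ do rewrite mulrA EFinM.
rewrite nneseriesZl; last by move=> i _; rewrite lee_fin exprn_ge0// divr_ge0// ltW.
rewrite nneseries_geometric; last by apply/andP; split; lra.
rewrite -EFinM lee_fin -mulrA ler_wpM2l//.
rewrite ler_pM ?(ltW b0) ?invr_ge0//; first lra.
by rewrite lef_pV2 ?posrE; lra.
Qed.

(** O'Neil's inequality for [g] in a weak Lebesgue space, sampled at the points
    [2^-m |Omega|]. On the layers of [f] that are larger than [2^-m |Omega|]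
    the convolution is bounded uniformly; on the smaller ones so is its part
    with [|g| <= g*(2^-m |Omega|)], while the remaining part, where both
    factors live on small sets, is only bounded in [L^1] and contributes through
    Chebyshev's inequality. *)
Lemma dyadic_convolution_le (b1 : R) : (b1 < 2)%R ->
  exists2 C : R, (0 < C)%R & forall f g (K be : R) m,
    measurable_fun Omega f -> measurable_fun Omega g ->
    (0 < K)%R -> (0 < be <= b1)%R ->
    (forall k, dyadic g k <= (K * be ^+ k)%:E) ->
    dyadic (convolution Omega f g) m <=
    (C * K)%:E * \sum_(j <oo) (2^-1 ^+ j * be ^+ minn j m)%:E * dyadic f j.+1.
Proof.
move=> b12.
have [b1le0|b10] := leP b1 0%R.
  exists 1%R => // f g K be m _ _ _ /andP[be0 beb1] _.
  by have := lt_le_trans be0 (le_trans beb1 b1le0); rewrite ltxx.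
have [L LE L0] : exists2 L, (L = b1 / (1 - b1 / 2))%R & (0 < L)%R.
  by eexists; [reflexivity|rewrite divr_gt0//; lra].
(* [4 ^ n.+1] comes from overlap_majorant, the other 4 from doubling the
   measures of two layers, which turns their bounds into strict ones *)
have [c4 c4E c40] : exists2 c, (c = 4 ^+ n.+1 * 4 :> R)%R & (0 < c)%R.
  by eexists; [reflexivity|rewrite mulr_gt0// exprn_gt0].
have D0 : (0 < 1 + L + c4 * L)%R by rewrite !addr_gt0// mulr_gt0.
have L10 : (0 < 1 + L)%R by rewrite addr_gt0.
have M0 : (0 <= M)%R by rewrite fine_ge0.
exists (M * (1 + L + c4 * L) + 1)%R.
  by rewrite ltr_wpDl// mulr_ge0// ltW.
move=> f g K be m mf mg K0 /andP[be0 beb1] gK.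
set S := \sum_(j <oo) _.
have F0 j : 0 <= dyadic f j by exact: dyadic_ge0.
have bep k : (0 <= be ^+ k)%R by rewrite exprn_ge0// ltW.
pose w j := (2^-1 ^+ j * be ^+ minn j m)%R.
have w0 j : (0 <= w j)%R by rewrite mulr_ge0.
have S0 : 0 <= S by apply: nneseries_ge0 => j _ _; rewrite mule_ge0 ?lee_fin ?w0.
have muE : mu Omega = M%:E by rewrite fineK// ge0_fin_numE.
move: M0; rewrite le_eqVlt => /predU1P[M0|M0].
  have -> : dyadic (convolution Omega f g) m = 0.
    by apply: rearrangement_total; rewrite [leLHS]muE lee_fin -M0 mulr0.
  apply: mule_ge0; last exact: S0.
  by rewrite lee_fin -M0 mul0r add0r mul1r ltW.
have KN : (0 <= K)%R by exact: ltW.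
have MN : (0 <= M)%R by exact: ltW.
have cN : (0 <= c4)%R by exact: ltW.
have LN : (0 <= L)%R by exact: ltW.
have L1N : (0 <= 1 + L)%R by exact: ltW.
apply: (@le_trans _ _ ((M * (1 + L + c4 * L) * K)%:E * S)); last first.
  by rewrite lee_wpmul2r// lee_fin ler_wpM2r ?lerDl// ltW.
case ES : S S0 => [sig| |]// S0; last first.
  by rewrite gt0_muley ?leey// lte_fin !mulr_gt0.
rewrite lee_fin in S0.
have psiE j k : exists psi : Rn R n -> \bar R, [/\ measurable_fun setT psi,
    forall y, 0 <= psi y,
    forall y : 'rV[R]_n.+1, mu (layer f j `&` (fun x => (y - x)%R) @^-1` layer g k)
      <= psi y &
    \int[mu]_y psi y <= (c4 * (2^-1 ^+ j * M * (2^-1 ^+ k * M)))%:E].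
  have small u i : measurable_fun Omega u ->
      lebesgue_outer (layer u i) < (2 * (2^-1 ^+ i * M))%:E.
    move=> mu_; apply: (le_lt_trans (layer_measure mOmega Omega_fin i mu_)).
    have : (0 < 2^-1 ^+ i * M)%R by rewrite mulr_gt0// exprn_gt0.
    by rewrite lte_fin => ?; lra.
  have [psi [? ? ? ipsi]] := overlap_majorant (small f j mf) (small g k mg).
  exists psi; split => //; apply: (le_trans ipsi); rewrite lee_fin c4E.
  by rewrite le_eqVlt; apply/orP; left; apply/eqP; ring.
have [psi psiP] := choice (fun jk : nat * nat => psiE jk.1 jk.2).
have mpsi j k : measurable_fun setT (psi (j, k)) by have [] := psiP (j, k).
have psi0 j k y : 0 <= psi (j, k) y by have [] := psiP (j, k).
have psi_ge j k (y : Rn R n) :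
    mu (layer f j `&` (fun x => ((y : 'rV[R]_n.+1) - x)%R) @^-1` layer g k)
      <= psi (j, k) y by have [] := psiP (j, k).
have ipsi j k : \int[mu]_y psi (j, k) y <= (c4 * (2^-1 ^+ j * M * (2^-1 ^+ k * M)))%:E.
  by have [] := psiP (j, k).
(* majorant of the convolution of the layer [j] with the part of [g] above
   its sample of index [m] *)
pose T j (y : Rn R n) := if (m <= j)%N then
  \sum_(i <oo) (K * be ^+ (m + i).+1)%:E * psi (j, (m + i)%N) y else 0.
have Kbe k : (0 <= K * be ^+ k)%R by rewrite mulr_ge0.
have KbeE k : 0 <= (K * be ^+ k)%:E by rewrite lee_fin.
have Tt0 j i y : 0 <= (K * be ^+ (m + i).+1)%:E * psi (j, (m + i)%N) y.
  by rewrite mule_ge0.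
have T0 j y : 0 <= T j y by rewrite /T; case: ifP => // _; apply: nneseries_ge0.
have mTt j i : measurable_fun setT
    (fun y => (K * be ^+ (m + i).+1)%:E * psi (j, (m + i)%N) y).
  by apply: emeasurable_funM; [exact: measurable_cst|exact: mpsi].
have mT j : measurable_fun setT (T j).
  rewrite /T; case: (m <= j)%N; last exact: measurable_cst.
  by apply: ge0_emeasurable_sum.
have iT j : \int[mu]_y T j y <= (2^-1 ^+ m * M * (K * M * c4 * L) * w j)%:E.
  rewrite /T; case: (boolP (m <= j)%N) => mj; last first.
    by rewrite integral0 lee_fin !mulr_ge0.
  rewrite integral_nneseries//.
  have -> : (2^-1 ^+ m * M * (K * M * c4 * L) * w j =
      2^-1 ^+ m * M * (K * M * c4) * w j * (b1 / (1 - b1 / 2)))%R.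
    by rewrite LE; ring.
  apply: le_trans; last apply: (nneseries_ratio (be := be)) => //.
  - apply: lee_nneseries => [i _ _|i _]; first by apply: integral_ge0.
    rewrite ge0_integralZl_EFin//.
    apply: (@le_trans _ _ ((K * be ^+ (m + i).+1)%:E *
       (c4 * (2^-1 ^+ j * M * (2^-1 ^+ (m + i) * M)))%:E)).
      by rewrite lee_wpmul2l.
    rewrite -EFinM lee_fin /w (minn_idPr mj) exprS !exprD exprMn.
    by rewrite le_eqVlt; apply/orP; left; apply/eqP; ring.
  - by rewrite be0.
  - by rewrite !mulr_ge0.
have bound j (y : Rn R n) :
    \int[mu]_(x in layer f j) `|(g \_ Omega) ((y : 'rV[R]_n.+1) - x)%R| <=
    (K * M * (1 + L) * w j)%:E + T j y.
  have mA : measurable (layer f j) by exact: measurable_layer.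
  apply: (le_trans (integral_reflection_layers mOmega Omega_fin y (minn j m) mg mA)).
  have h1 : dyadic g (minn j m) * mu (layer f j) <= (K * M * w j)%:E.
    apply: (@le_trans _ _ ((K * be ^+ minn j m)%:E * (2^-1 ^+ j * M)%:E)).
      apply: lee_pmul; [exact: dyadic_ge0|exact: measure_ge0|exact: gK|].
      exact: layer_measure.
    rewrite -EFinM lee_fin /w.
    by rewrite le_eqVlt; apply/orP; left; apply/eqP; ring.
  rewrite mulrDr mulr1 mulrDl EFinD -addeA leeD//.
  have [jm|mj] := ltnP j m; last first.
    apply: lee_paddl; first by rewrite lee_fin !mulr_ge0.
    rewrite /T mj; apply: lee_nneseries => [i _ _|i _].
      by rewrite mule_ge0 ?dyadic_ge0.
    apply: lee_pmul; [exact: dyadic_ge0|exact: measure_ge0|exact: gK|].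
    exact: psi_ge.
  apply: lee_paddr; first exact: T0.
  have -> : (K * M * L * w j = K * M * w j * (b1 / (1 - b1 / 2)))%R by rewrite LE; ring.
  apply: le_trans; last apply: (nneseries_ratio (be := be)) => //; last 2 first.
  - by rewrite be0.
  - by rewrite !mulr_ge0.
  rewrite /w (minn_idPl (ltnW jm)).
  apply: lee_nneseries => [i _ _|i _]; first by rewrite mule_ge0 ?dyadic_ge0.
  apply: (@le_trans _ _ ((K * be ^+ (j + i).+1)%:E * (2^-1 ^+ (j + i) * M)%:E)).
    apply: lee_pmul; [exact: dyadic_ge0|exact: measure_ge0|exact: gK|].
    apply: le_trans (layer_measure mOmega Omega_fin (j + i) mg).
    rewrite -[leRHS](lebesgue_Rn_reflection y).
    by apply: le_lebesgue_Rn; exact: subIsetr.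
  rewrite -EFinM lee_fin exprS !exprD exprMn.
  by rewrite le_eqVlt; apply/orP; left; apply/eqP; ring.
pose TT y := \sum_(j <oo) dyadic f j.+1 * T j y.
have FT0 j y : 0 <= dyadic f j.+1 * T j y by rewrite mule_ge0.
have mFT j : measurable_fun setT (fun y => dyadic f j.+1 * T j y).
  by apply: emeasurable_funM; [exact: measurable_cst|exact: mT].
have scale c : (0 <= c)%R ->
    \sum_(j <oo) dyadic f j.+1 * (c * w j)%:E = (c * sig)%:E.
  move=> c0; rewrite EFinM -ES -nneseriesZl; last first.
    by move=> j _; rewrite mule_ge0// lee_fin w0.
  by apply: eq_eseriesr => j _; rewrite EFinM muleC muleA.
have -> : (M * (1 + L + c4 * L) * K)%:E * sig%:E =
    (K * M * (1 + L) * sig + K * M * c4 * L * sig)%:E.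
  by rewrite -EFinM; congr _%:E; ring.
apply: (@rearrangement_le_chebyshev _ _ _ _ TT).
- by rewrite !mulr_ge0.
- by rewrite !mulr_ge0.
- by rewrite mulr_gt0// exprn_gt0.
- exact: ge0_emeasurable_sum.
- by move=> y; apply: nneseries_ge0.
- move=> y; apply: (le_trans (convolution_layers mOmega Omega_fin y mf mg)).
  rewrite -scale; last by rewrite !mulr_ge0.
  have a0 j : (0 <= K * M * (1 + L) * w j)%R by rewrite !mulr_ge0.
  rewrite -nneseriesD => [|j _ _|j _ _]; last 2 first.
  + by rewrite mule_ge0// lee_fin.
  + exact: FT0.
  apply: lee_nneseries => [j _ _|j _].
    by rewrite mule_ge0//; apply: integral_ge0.
  rewrite -ge0_muleDr ?lee_fin ?a0//.
  by apply: lee_wpmul2l; [exact: F0|exact: bound].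
- rewrite integral_nneseries//.
  rewrite mulrA -scale; last by rewrite !mulr_ge0.
  apply: lee_nneseries => [j _ _|j _]; first by apply: integral_ge0.
  rewrite ge0_integralZl//.
  by apply: lee_wpmul2l; [exact: F0|exact: iT].
Qed.

End dyadic_oneil.

(** * Lorentz quasinorms and dyadic samples *)

Section dyadic_intervals.
Context {R : realType}.

Definition dyadic_itv (k : nat) : set R := `[(2^-1 ^+ k.+1)%R, (2^-1 ^+ k)%R[%classic.

Lemma half_exp_gt0 k : (0 < 2^-1 ^+ k :> R)%R.
Proof. by rewrite exprn_gt0. Qed.

Lemma half_exp_le i j : (i <= j)%N -> (2^-1 ^+ j <= 2^-1 ^+ i :> R)%R.
Proof. by move=> ij; rewrite ler_wiXn2l// invf_le1// ler1n. Qed.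

Lemma dyadic_itvP (t : R) : (0 < t < 1)%R -> exists k, dyadic_itv k t.
Proof.
move=> /andP[t0 t1].
have ex : exists k, (2^-1 ^+ k <= t)%R.
  have [k _ /(_ k (leqnn k)) kt] := near_infty_natSinv_lt (PosNum t0).
  exists k.+1; apply: le_trans (ltW kt).
  rewrite exprVn lef_pV2 ?posrE ?exprn_gt0//.
  by rewrite -natrX ler_nat ltnW// ltn_expl.
case: (ex_minnP ex) => -[|k] kt kmin.
  by have := le_lt_trans kt t1; rewrite expr0 ltxx.
exists k; rewrite /dyadic_itv/= in_itv/= kt/= ltNge; apply/negP => /kmin.
by rewrite ltnn.
Qed.

Lemma dyadic_itv_inj i j (t : R) : dyadic_itv i t -> dyadic_itv j t -> i = j.
Proof.
have H i' j' : dyadic_itv i' t -> dyadic_itv j' t -> (i' < j')%N -> False.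
  rewrite /dyadic_itv/= !in_itv/= => /andP[it _] /andP[_ tj] ij.
  by have := lt_le_trans (le_lt_trans it tj) (half_exp_le ij); rewrite ltxx.
move=> it jt; case: (ltngtP i j) => // ij; exfalso.
- exact: H it jt ij.
- exact: H jt it ij.
Qed.

Lemma dyadic_itv_gt0lt1 k (t : R) : dyadic_itv k t -> (0 < t < 1)%R.
Proof.
rewrite /dyadic_itv/= in_itv/= => /andP[kt tk]; rewrite (lt_le_trans _ kt)//.
by rewrite (lt_le_trans tk)// (half_exp_le (leq0n k)).
Qed.

(** The integral of a nonnegative function is a supremum over the simple functions
    below it, hence monotone without any measurability. It serves to compare the
    integrand of a Lorentz quasinorm with step functions. *)
Lemma ge0_le_integral_any d (T : measurableType d)
    (mu : {measure set T -> \bar R}) (D : set T) (f g : T -> \bar R) :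
  (forall x, D x -> 0 <= f x) -> (forall x, D x -> f x <= g x) ->
  \int[mu]_(x in D) f x <= \int[mu]_(x in D) g x.
Proof.
move=> f0 fg; have g0 x : D x -> 0 <= g x by move=> Dx; rewrite (le_trans (f0 _ Dx) (fg _ Dx)).
rewrite !ge0_integralE//; apply: ereal_sup_le => _ [h hf <-]; exists h => // x.
apply: (le_trans (hf x)); rewrite !patchE; case: ifPn => // xD.
by apply: fg; rewrite inE in xD.
Qed.

Definition dyadic_step (c : nat -> \bar R) (t : R) : \bar R :=
  \sum_(k <oo) c k * (\1_(dyadic_itv k) t)%:E.

Lemma dyadic_stepE c k t : (forall i, 0 <= c i) -> dyadic_itv k t ->
  dyadic_step c t = c k.
Proof.
move=> c0 kt; rewrite /dyadic_step (nneseriesD1 (n := k))//; last first.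
  by move=> i _; rewrite mule_ge0 ?lee_fin.
rewrite indicE mem_set// mule1 eseries0 ?adde0// => i _ /= ik.
rewrite indicE memNset ?mule0// => it.
by move: ik; rewrite (dyadic_itv_inj it kt) eqxx.
Qed.

Lemma integral_dyadic_step c : (forall i, 0 <= c i) ->
  \int[lebesgue_measure]_(t in `]0%R, 1%R[) dyadic_step c t =
  \sum_(k <oo) c k * (2^-1 ^+ k.+1)%:E.
Proof.
move=> c0.
have mI k : measurable (dyadic_itv k : set R) by exact: measurable_itv.
have m1 k : measurable_fun (`]0%R, 1%R[%classic : set R)
    (fun t : R => (\1_(dyadic_itv k) t)%:E : \bar R).
  by apply/measurable_EFinP; exact: measurable_indic.
rewrite integral_nneseries//; last 2 first.
- by move=> k; apply: emeasurable_funM; [exact: measurable_cst|exact: m1].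
- by move=> k t _; rewrite mule_ge0 ?lee_fin.
apply: eq_eseriesr => k _; rewrite ge0_integralZl//; last exact: m1.
rewrite integral_indic//; last exact: mI.
rewrite setIidl; last by move=> t /dyadic_itv_gt0lt1; rewrite /= in_itv.
congr (_ * _); rewrite [LHS]lebesgue_measure_itv/= lte_fin.
have h : (2^-1 ^+ k = 2^-1 ^+ k.+1 + 2^-1 ^+ k.+1 :> R)%R by rewrite exprS; lra.
by rewrite ifT -?EFinD; [rewrite h addrK|rewrite h ltrDl half_exp_gt0].
Qed.

End dyadic_intervals.

Section lorentz_dyadic.
Context {R : realType} {n : nat} (Omega : set (Rn R n)).
Local Notation mu := (@lebesgue_Rn R n).
Implicit Types (u : Rn R n -> \bar R) (a : R).
Local Notation M := (fine (mu Omega)).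
Local Notation dyadic := (dyadic Omega).

Lemma lorentz_qnorm_ge0 a (q : \bar R) u : 0 <= lorentz_qnorm Omega a q u.
Proof.
rewrite /lorentz_qnorm; case: q => [q| |]//; first exact: poweR_ge0.
apply: (@le_trans _ _ ((2^-1 `^ a)%:E * rearrangement Omega u (2^-1 * M))).
  by rewrite mule_ge0 ?rearrangement_ge0// lee_fin powR_ge0.
apply: ereal_sup_ubound; exists 2^-1%R => //=.
by rewrite in_itv/=; apply/andP; split; lra.
Qed.

Let rearr_itv u k t : dyadic_itv k t ->
  dyadic u k <= rearrangement Omega u (t * M) <= dyadic u k.+1.
Proof.
have M0 : (0 <= M)%R by rewrite fine_ge0.
rewrite /dyadic_itv/= in_itv/= => /andP[kt tk].
by apply/andP; split; apply: rearrangement_anti; rewrite ler_wpM2r// ltW.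
Qed.

Let powR_itv a k t : (0 <= a)%R -> dyadic_itv k t ->
  ((2^-1 ^+ k.+1) `^ a <= t `^ a <= (2^-1 ^+ k) `^ a)%R.
Proof.
move=> a0 kt; have /andP[t0 _] := dyadic_itv_gt0lt1 kt.
move: kt; rewrite /dyadic_itv/= in_itv/= => /andP[kt tk].
by apply/andP; split; apply: ge0_ler_powR; rewrite ?nnegrE ?(ltW (half_exp_gt0 _))// ltW.
Qed.

(** On [dyadic_itv k] both factors of the integrand are bounded by their values
    at the endpoints, and [dt / t] gives this interval a mass between [1/2] and
    [1]. *)
Lemma lorentz_le_dyadic a (tau : R) u : (0 <= a)%R -> (0 < tau)%R ->
  lorentz_qnorm Omega a tau%:E u <=
  (\sum_(k <oo) (((2^-1 ^+ k) `^ a)%:E * dyadic u k.+1) `^ tau) `^ tau^-1.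
Proof.
move=> a0 tau0; rewrite /lorentz_qnorm.
pose v k := ((2^-1 ^+ k) `^ a)%:E * dyadic u k.+1.
pose c k := v k `^ tau * (2 ^+ k.+1)%:E.
have v0 k : 0 <= v k by rewrite mule_ge0 ?dyadic_ge0// lee_fin powR_ge0.
have c0 k : 0 <= c k by rewrite mule_ge0 ?poweR_ge0// lee_fin exprn_ge0.
have -> : \sum_(k <oo) v k `^ tau = \sum_(k <oo) c k * (2^-1 ^+ k.+1)%:E.
  apply: eq_eseriesr => k _.
  by rewrite -muleA -EFinM -exprMn divff// expr1n mule1.
rewrite -integral_dyadic_step//.
apply: ge0_lee_poweR; first by rewrite invr_ge0 ltW.
  apply: integral_ge0 => t; rewrite /= in_itv/= => /andP[t0 _].
  by rewrite mule_ge0 ?poweR_ge0// lee_fin invr_ge0 ltW.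
apply: ge0_le_integral_any => t; rewrite /= in_itv/= => t01.
  by rewrite mule_ge0 ?poweR_ge0// lee_fin invr_ge0; case/andP: t01 => /ltW.
have [k kt] := dyadic_itvP t01; rewrite (dyadic_stepE c0 kt).
have /andP[t0 t1] := t01.
apply: lee_pmul; [exact: poweR_ge0|by rewrite lee_fin invr_ge0 ltW| |].
  apply: ge0_lee_poweR; first exact: ltW.
    by rewrite mule_ge0 ?rearrangement_ge0// lee_fin powR_ge0.
  have /andP[_ h1] := rearr_itv u kt; have /andP[_ h2] := powR_itv a0 kt.
  by apply: lee_pmul; rewrite ?lee_fin ?powR_ge0 ?rearrangement_ge0.
rewrite lee_fin -[leRHS]invrK -exprVn lef_pV2 ?posrE ?half_exp_gt0//.
by move: kt; rewrite /dyadic_itv/= in_itv/= => /andP[].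
Qed.

Lemma dyadic_le_lorentz a (tau : R) u : (0 <= a)%R -> (0 < tau)%R ->
  \sum_(k <oo) (((2^-1 ^+ k.+1) `^ a)%:E * dyadic u k) `^ tau <=
  2%:E * lorentz_qnorm Omega a tau%:E u `^ tau.
Proof.
move=> a0 tau0; rewrite /lorentz_qnorm poweRKV//; last first.
  apply: integral_ge0 => t; rewrite /= in_itv/= => /andP[t0 _].
  by rewrite mule_ge0 ?poweR_ge0// lee_fin invr_ge0 ltW.
pose v k := ((2^-1 ^+ k.+1) `^ a)%:E * dyadic u k.
pose c k := v k `^ tau * (2 ^+ k)%:E.
have v0 k : 0 <= v k by rewrite mule_ge0 ?dyadic_ge0// lee_fin powR_ge0.
have c0 k : 0 <= c k by rewrite mule_ge0 ?poweR_ge0// lee_fin exprn_ge0.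
have -> : \sum_(k <oo) v k `^ tau = 2%:E * \sum_(k <oo) c k * (2^-1 ^+ k.+1)%:E.
  rewrite -nneseriesZl => [|k _]; last by rewrite mule_ge0 ?lee_fin ?exprn_ge0.
  apply: eq_eseriesr => k _.
  have e : (2 * (2 ^+ k * 2^-1 ^+ k.+1) = 1 :> R)%R.
    rewrite exprS mulrCA [X in (2 ^+ k * X)%R]mulrA divff// mul1r.
    by rewrite -exprMn divff// expr1n.
  by rewrite /c -muleA -EFinM muleCA -EFinM e mule1.
rewrite -integral_dyadic_step// lee_wpmul2l//.
have cs t : (0 < t < 1)%R -> 0 <= dyadic_step c t.
  by move=> _; apply: nneseries_ge0 => k _ _; rewrite mule_ge0 ?lee_fin.
apply: ge0_le_integral_any => t; rewrite /= in_itv/= => t01; first exact: cs.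
have [k kt] := dyadic_itvP t01; rewrite (dyadic_stepE c0 kt).
have /andP[t0 t1] := t01.
apply: lee_pmul; [exact: poweR_ge0|by rewrite lee_fin exprn_ge0| |].
  apply: ge0_lee_poweR; [exact: ltW|exact: v0|].
  have /andP[h1 _] := rearr_itv u kt; have /andP[h2 _] := powR_itv a0 kt.
  by apply: lee_pmul; rewrite ?lee_fin ?powR_ge0 ?dyadic_ge0.
rewrite lee_fin -[leLHS]invrK -exprVn lef_pV2 ?posrE ?half_exp_gt0//.
by move: kt; rewrite /dyadic_itv/= in_itv/= => /andP[_ /ltW].
Qed.

Lemma lorentzy_le_dyadic a u (X : \bar R) : (0 <= a)%R ->
  (forall k, ((2^-1 ^+ k) `^ a)%:E * dyadic u k.+1 <= X) ->
  lorentz_qnorm Omega a +oo u <= X.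
Proof.
move=> a0 uX; apply: ge_ereal_sup => _ [t + <-]; rewrite /= in_itv/= => t01.
have [k kt] := dyadic_itvP t01; apply: le_trans (uX k).
have /andP[_ h1] := rearr_itv u kt; have /andP[_ h2] := powR_itv a0 kt.
by apply: lee_pmul; rewrite ?lee_fin ?powR_ge0 ?rearrangement_ge0.
Qed.

Lemma dyadic_le_lorentzy a u k :
  ((2^-1 ^+ k.+1) `^ a)%:E * dyadic u k.+1 <= lorentz_qnorm Omega a +oo u.
Proof.
apply: ereal_sup_ubound; exists (2^-1 ^+ k.+1)%R => //=.
by rewrite in_itv/= half_exp_gt0/= exprn_ilt1// invf_lt1// ltr1n.
Qed.

Lemma lorentz_anti a a' (tau : \bar R) u : 0 < tau -> (a <= a')%R ->
  lorentz_qnorm Omega a' tau u <= lorentz_qnorm Omega a tau u.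
Proof.
move=> tau0 aa'.
have mono t : (0 < t < 1)%R -> (t `^ a')%:E * rearrangement Omega u (t * M) <=
    (t `^ a)%:E * rearrangement Omega u (t * M).
  move=> /andP[t0 t1]; rewrite lee_wpmul2r ?rearrangement_ge0// lee_fin.
  by apply: ger_powR => //; rewrite t0 ltW.
have ge0 t b : 0 <= (t `^ b)%:E * rearrangement Omega u (t * M).
  by rewrite mule_ge0 ?rearrangement_ge0// lee_fin powR_ge0.
case: tau tau0 => [q| |] q0; last by [].
  rewrite lte_fin in q0; apply: ge0_lee_poweR; first by rewrite invr_ge0 ltW.
    apply: integral_ge0 => t; rewrite /= in_itv/= => /andP[t0 _].
    by rewrite mule_ge0 ?poweR_ge0// lee_fin invr_ge0 ltW.
  apply: ge0_le_integral_any => t; rewrite /= in_itv/= => t01.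
    by rewrite mule_ge0 ?poweR_ge0// lee_fin invr_ge0; case/andP: t01 => /ltW.
  apply: lee_wpmul2r; first by rewrite lee_fin invr_ge0; case/andP: t01 => /ltW.
  by apply: ge0_lee_poweR; [exact: ltW|exact: ge0|exact: mono].
apply: ge_ereal_sup => _ [t t01 <-].
apply: (le_trans (mono t _)); first by move: t01; rewrite /= in_itv.
by apply: ereal_sup_ubound; exists t.
Qed.

End lorentz_dyadic.

(** * Young's inequality with a weak factor *)

Section dyadic_weights.
Context {R : realType}.
Implicit Types a b : R.

Let half_powR k a : ((2^-1 ^+ k) `^ a = 2 `^ (- (k%:R * a)) :> R)%R.
Proof. by rewrite exprVn -powR_invn// -powRrM mulNr. Qed.

Let powR_exp b k : ((2 `^ b) ^+ k = 2 `^ (b * k%:R) :> R)%R.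
Proof. by rewrite -powR_mulrn ?powR_ge0// -powRrM. Qed.

Let half_exp k : (2^-1 ^+ k = 2 `^ (- k%:R) :> R)%R.
Proof. by rewrite exprVn -powR_invn. Qed.

Let powR2D a b : (2 `^ a * 2 `^ b = 2 `^ (a + b) :> R)%R.
Proof. by rewrite powRD//; apply/implyP. Qed.

Let ler_powR2 a b : (a <= b)%R -> (2 `^ a <= 2 `^ b :> R)%R.
Proof. by move=> ab; apply: ler_powR; rewrite ?ler1n. Qed.

(** Comparing the exponents of 2, the gain is [(1 - a)(j - m)] if [m <= j] and
    [(a + b - 1)(m - j)] if [j < m]; both are at least [kap |j - m|]. *)
Lemma dyadic_weight (kap a b : R) j m : (a <= 1 - kap)%R -> (kap <= a + b - 1)%R ->
  ((2^-1 ^+ m) `^ (a + b - 1) * (2^-1 ^+ j * (2 `^ b) ^+ minn j m) <=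
   (2 `^ (- kap)) ^+ natdist j m * (2^-1 ^+ j) `^ a)%R.
Proof.
move=> ha hc; rewrite !half_powR !powR_exp half_exp !powR2D; apply: ler_powR2.
rewrite /natdist natrD.
have [jm|mj] := leqP j m.
  have jmR : (j%:R <= m%:R :> R)%R by rewrite ler_nat.
  rewrite (eqP (jm : j - m == 0)%N) natrB// ?(minn_idPl jm).
  by nra.
have mjR : (m%:R <= j%:R :> R)%R by rewrite ler_nat ltnW.
rewrite (eqP (ltnW mj : m - j == 0)%N) natrB ?(ltnW mj)// ?(minn_idPr (ltnW mj)).
by nra.
Qed.

Lemma half_powR_shift a i j k : (0 <= a)%R -> (a * j%:R <= k%:R)%R ->
  ((2^-1 ^+ i) `^ a <= 2 ^+ k * (2^-1 ^+ (i + j)) `^ a)%R.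
Proof.
move=> a0 ak; rewrite !half_powR -powR_mulrn// powR2D; apply: ler_powR2.
by rewrite natrD; lra.
Qed.

Lemma half_powR_perturb a e i : (e * i%:R <= 1)%R ->
  ((2^-1 ^+ i) `^ a <= 2 * (2^-1 ^+ i) `^ (a + e))%R.
Proof.
move=> ei; rewrite !half_powR -[X in (_ <= X * _)%R](@powRr1 _ 2)// powR2D.
by apply: ler_powR2; lra.
Qed.

Lemma half_powR_inv b k : ((2^-1 ^+ k) `^ b * (2 `^ b) ^+ k = 1)%R.
Proof. by rewrite half_powR powR_exp powR2D mulrC addNr powRr0. Qed.

Lemma powR2_lt a : (a < 1)%R -> (2 `^ a < 2)%R.
Proof.
move=> a1; rewrite -[ltRHS](@powRr1 _ 2)//.
rewrite -[X in (_ < _ `^ X)%R](subrK a) addrC -powR2D ltr_pMr ?powR_gt0//.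
have := @gt0_ltr_powR R (1 - a)%R; rewrite subr_gt0 => /(_ a1 1%R 2%R).
by rewrite powR1; apply; rewrite ?nnegrE// ltr1n.
Qed.

Lemma powR2_le a b : (a <= b)%R -> (2 `^ a <= 2 `^ b :> R)%R.
Proof. exact: ler_powR2. Qed.

End dyadic_weights.

Section lorentz_convolution.
Context {R : realType} {n : nat} (Omega : set (Rn R n)).
Local Notation mu := (@lebesgue_Rn R n).
Implicit Types (u f g : Rn R n -> \bar R) (a b : R).
Hypothesis mOmega : measurable Omega.
Hypothesis Omega_fin : mu Omega < +oo.
Local Notation dyadic := (dyadic Omega).

Lemma weak_dyadic_le g b (K : R) k : (0 < K)%R ->
  lorentz_qnorm Omega b +oo g <= K%:E -> dyadic g k <= (K * (2 `^ b) ^+ k)%:E.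
Proof.
move=> K0 gK; case: k => [|k].
  by rewrite dyadic0// lee_fin mulr_ge0// ltW.
have := le_trans (dyadic_le_lorentzy Omega b g k) gK.
have p0 : (0 < (2^-1 ^+ k.+1) `^ b :> R)%R by rewrite powR_gt0// half_exp_gt0.
rewrite -lee_pdivlMl// => /le_trans; apply.
rewrite -EFinM lee_fin ler_pdivrMl// mulrCA half_powR_inv mulr1//.
Qed.

(** The dyadic form of O'Neil's inequality with power weights, as a discrete
    convolution with a geometric kernel. The samples of [f] are weighted with
    [2^-(j+2)], the left endpoint of the interval where [dyadic f j.+1] is a lower
    bound for the rearrangement. *)
Lemma weighted_dyadic_le (kap b1 : R) : (0 < kap)%R -> (b1 < 1)%R ->
  exists2 C : R, (0 < C)%R & forall f g (K a b : R) k,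
    measurable_fun Omega f -> measurable_fun Omega g -> (0 < K)%R ->
    (a <= 1 - kap)%R -> (b <= b1)%R -> (kap <= a + b - 1)%R ->
    lorentz_qnorm Omega b +oo g <= K%:E ->
    ((2^-1 ^+ k) `^ (a + b - 1))%:E * dyadic (convolution Omega f g) k.+1 <=
    (C * K)%:E * \sum_(j <oo) ((2 `^ (- kap)) ^+ natdist j k.+1)%:E *
      (((2^-1 ^+ j.+2) `^ a)%:E * dyadic f j.+1).
Proof.
move=> kap0 b11.
have [C C0 HC] := dyadic_convolution_le mOmega Omega_fin (powR2_lt b11).
(* 8 = 2 * 4 pays for replacing [2^-k] by [2^-(k+1)] and [2^-j] by [2^-(j+2)] *)
exists (8 * C)%R; first by rewrite mulr_gt0.
move=> f g K a b k mf mg K0 ha hb hc gK.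
have K0' := ltW K0; have C0' := ltW C0.
have b0 : (0 < 2 `^ b <= 2 `^ b1)%R by rewrite powR_gt0//= powR2_le.
have H := HC f g K (2 `^ b)%R k.+1 mf mg K0 b0 (fun i => weak_dyadic_le i K0 gK).
have p0 i c : (0 <= (2^-1 ^+ i) `^ c :> R)%R by exact: powR_ge0.
apply: (@le_trans _ _ ((2 * (2^-1 ^+ k.+1) `^ (a + b - 1))%:E *
    ((C * K)%:E * \sum_(j <oo) (2^-1 ^+ j * (2 `^ b) ^+ minn j k.+1)%:E * dyadic f j.+1))).
  apply: lee_pmul => //; rewrite ?lee_fin ?dyadic_ge0//.
  have := @half_powR_shift R (a + b - 1) k 1 1; rewrite expr1 addn1; apply; lra.
have q0 i c : (0 <= (2 `^ c) ^+ i :> R)%R by rewrite exprn_ge0// powR_ge0.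
have h0 i : (0 <= 2^-1 ^+ i :> R)%R by rewrite ltW// half_exp_gt0.
have t0 j : 0 <= (2^-1 ^+ j * (2 `^ b) ^+ minn j k.+1)%:E * dyadic f j.+1.
  by rewrite mule_ge0 ?dyadic_ge0// lee_fin mulr_ge0.
have t0' j : 0 <= ((2 `^ (- kap)) ^+ natdist j k.+1)%:E *
      (((2^-1 ^+ j.+2) `^ a)%:E * dyadic f j.+1).
  by rewrite !mule_ge0 ?dyadic_ge0 ?lee_fin.
set S := \sum_(j <oo) _; set S' := \sum_(j <oo) _.
suff key : ((2^-1 ^+ k.+1) `^ (a + b - 1))%:E * S <= 4%:E * S'.
  rewrite EFinM -muleA [X in 2%:E * X]muleCA muleA -EFinM.
  have -> : (8 * C * K = 2 * (C * K) * 4)%R by ring.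
  rewrite [in leRHS]EFinM -[leRHS]muleA; apply: lee_wpmul2l => //.
  by rewrite lee_fin !mulr_ge0.
rewrite /S /S' -!nneseriesZl//.
apply: lee_nneseries => [j _ _|j _]; first by rewrite mule_ge0// lee_fin.
rewrite !muleA -!EFinM; apply: lee_wpmul2r; first exact: dyadic_ge0.
rewrite lee_fin; apply: (le_trans (dyadic_weight _ _ ha hc)).
rewrite mulrAC mulrC; apply: ler_wpM2r; first exact: q0.
by have := @half_powR_shift R a j 2 2; rewrite addn2 expr2 -natrM; apply; lra.
Qed.

(** Young's inequality for convolution with a weak Lebesgue function. The
    constant depends on the exponents only through upper bounds for [a] and [b]
    below [1] and a lower bound for [a + b - 1] above [0]. *)
Lemma lorentz_convolution_le (kap b1 : R) (tau : \bar R) :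
  (0 < kap)%R -> (b1 < 1)%R -> 0 < tau ->
  exists2 C : R, (0 < C)%R & forall f g (K a b : R),
    measurable_fun Omega f -> measurable_fun Omega g -> (0 < K)%R ->
    (a <= 1 - kap)%R -> (b <= b1)%R -> (kap <= a + b - 1)%R ->
    lorentz_qnorm Omega b +oo g <= K%:E ->
    lorentz_qnorm Omega (a + b - 1) tau (convolution Omega f g) <=
    (C * K)%:E * lorentz_qnorm Omega a tau f.
Proof.
move=> kap0 b11 tau0; have [C C0 HC] := weighted_dyadic_le kap0 b11.
have C0' := ltW C0.
pose s : R := (2 `^ (- (kap / 2)))%R.
have s0 : (0 < s)%R by rewrite powR_gt0.
have s1 : (s < 1)%R.
  rewrite /s powRN invf_lt1 ?powR_gt0//.
  have := @gt0_ltr_powR R (kap / 2)%R; rewrite divr_gt0// => /(_ isT 1%R 2%R).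
  by rewrite powR1; apply; rewrite ?nnegrE// ltr1n.
have s01 : (0 < s < 1)%R by rewrite s0.
have ss : (s ^+ 2 = 2 `^ (- kap))%R.
  rewrite expr2 -powRD; first by congr (_ `^ _)%R; lra.
  by apply/implyP.
case: tau tau0 => [tau| |] tau0; last by [].
  rewrite lte_fin in tau0; have [CH CH0 HH] := discrete_hardy s01 tau0.
  exists (C * (CH * 2) `^ tau^-1)%R; first by rewrite mulr_gt0// powR_gt0// mulr_gt0.
  move=> f g K a b mf mg K0 ha hb hc gK; have K0' := ltW K0.
  apply: (le_trans (lorentz_le_dyadic _ _ _ _)) => //; first lra.
  have tau'0 : (0 <= tau^-1)%R by rewrite invr_ge0 ltW.
  pose x j := ((2^-1 ^+ j.+2) `^ a)%:E * dyadic f j.+1.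
  have x0 j : 0 <= x j by rewrite mule_ge0 ?dyadic_ge0// lee_fin powR_ge0.
  have sx0 m : 0 <= \sum_(j <oo) ((s ^+ 2) ^+ natdist j m)%:E * x j.
    apply: nneseries_ge0 => j _ _.
    by rewrite mule_ge0// lee_fin exprn_ge0// exprn_ge0// ltW.
  set N := lorentz_qnorm _ _ _ _.
  have N0 : 0 <= N by exact: lorentz_qnorm_ge0.
  apply: (@le_trans _ _ ((((C * K) `^ tau)%:E *
      (CH%:E * (2%:E * N `^ tau))) `^ tau^-1)); last first.
    rewrite !poweRM ?mule_ge0 ?lee_fin ?powR_ge0 ?poweR_ge0 ?(ltW CH0)//.
    rewrite !poweR_EFin -powRrM mulfV ?gt_eqF// powRr1 ?mulr_ge0// poweRK//.
    rewrite powRM ?(ltW CH0)// !muleA -!EFinM.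
    by rewrite [in leRHS]mulrAC !mulrA.
  apply: ge0_lee_poweR => //.
    by apply: nneseries_ge0 => k _ _; exact: poweR_ge0.
  apply: (@le_trans _ _ (\sum_(k <oo) ((C * K) `^ tau)%:E *
     (\sum_(j <oo) ((s ^+ 2) ^+ natdist j k.+1)%:E * x j) `^ tau)).
    apply: lee_nneseries => [k _ _|k _]; first exact: poweR_ge0.
    rewrite -(poweR_EFin (C * K)) -poweRM ?lee_fin ?mulr_ge0//.
    apply: ge0_lee_poweR; first exact: ltW.
      by rewrite mule_ge0 ?dyadic_ge0// lee_fin powR_ge0.
    by rewrite ss; exact: HC.
  rewrite nneseriesZl; last by move=> k _; exact: poweR_ge0.
  apply: lee_wpmul2l; first by rewrite lee_fin powR_ge0.
  have shift (v : nat -> \bar R) : (forall i, 0 <= v i) ->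
      \sum_(k <oo) v k.+1 <= \sum_(k <oo) v k.
    move=> v0; rewrite [leRHS](nneseries_split _ 1)//.
    rewrite (_ : \sum_(k <oo) v k.+1 = \sum_(1 <= k <oo) v k).
      by apply: lee_paddl => //; apply: sume_ge0.
    by rewrite -[RHS]nneseries_addn//; apply: eq_eseriesr => k _; rewrite addn1.
  apply: le_trans (shift (fun m => (\sum_(j <oo) ((s ^+ 2) ^+ natdist j m)%:E * x j) `^ tau) _) _.
    by move=> i; exact: poweR_ge0.
  apply: (le_trans (HH x x0)); apply: lee_wpmul2l; first by rewrite lee_fin ltW.
  apply: le_trans (shift (fun k => (((2^-1 ^+ k.+1) `^ a)%:E * dyadic f k) `^ tau) _) _.
    by move=> i; exact: poweR_ge0.
  by apply: dyadic_le_lorentz => //; lra.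
have ss1 : (0 < s ^+ 2 < 1)%R by rewrite exprn_gt0//= exprn_ilt1// ltW.
exists (C * (2 / (1 - s ^+ 2)))%R.
  by rewrite mulr_gt0// divr_gt0// subr_gt0; case/andP: ss1.
move=> f g K a b mf mg K0 ha hb hc gK; have K0' := ltW K0.
apply: lorentzy_le_dyadic; first lra.
move=> k; apply: (le_trans (HC f g K a b k mf mg K0 ha hb hc gK)).
rewrite [in leRHS]mulrAC [in leRHS]EFinM -[leRHS]muleA.
apply: lee_wpmul2l; first by rewrite lee_fin mulr_ge0.
set N := lorentz_qnorm _ _ _ _.
have N0 : 0 <= N by exact: lorentz_qnorm_ge0.
apply: (@le_trans _ _ (\sum_(j <oo) ((s ^+ 2) ^+ natdist j k.+1)%:E * N)).
  apply: lee_nneseries => [j _ _|j _].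
    by rewrite !mule_ge0 ?dyadic_ge0 ?lee_fin ?powR_ge0// exprn_ge0// powR_ge0.
  rewrite ss; apply: lee_wpmul2l; first by rewrite lee_fin exprn_ge0// powR_ge0.
  apply: le_trans (dyadic_le_lorentzy Omega a f j).
  apply: lee_wpmul2r; first exact: dyadic_ge0.
  rewrite lee_fin; apply: ge0_ler_powR; rewrite ?nnegrE ?(ltW (half_exp_gt0 _))//; first lra.
  exact: half_exp_le.
apply: nneseriesZr_le => //.
- by move=> j; rewrite exprn_ge0// exprn_ge0// ltW.
- by rewrite divr_gt0// subr_gt0; case/andP: ss1.
- exact: nneseries_geometric_dist.
Qed.

(** A substitute for monotone convergence as [e] tends to [0], with a constant:
    on the first [N] dyadic intervals [t ^ a <= 2 t ^ (a + e)] for [e] of order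
    [1/N], and the bound for these partial sums does not depend on [N]. *)
Lemma lorentz_right_limit (tau : \bar R) : 0 < tau ->
  exists2 C : R, (0 < C)%R & forall u a (X : R), (0 <= a <= 1)%R -> (0 <= X)%R ->
    (forall e, (0 < e < 1)%R -> lorentz_qnorm Omega (a + e) tau u <= X%:E) ->
    lorentz_qnorm Omega a tau u <= (C * X)%:E.
Proof.
case: tau => [tau| |] tau0; last by [].
  rewrite lte_fin in tau0; have tau'0 : (0 <= tau^-1)%R by rewrite invr_ge0 ltW.
  exists (32 * 2 `^ tau^-1)%R; first by rewrite mulr_gt0// powR_gt0.
  move=> u a X /andP[a0 a1] X0 uX.
  apply: (le_trans (lorentz_le_dyadic _ _ a0 tau0)).
  have -> : ((32 * 2 `^ tau^-1 * X)%:E =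
     ((32 `^ tau)%:E * (2 * (X `^ tau))%:E) `^ tau^-1).
    rewrite -EFinM poweR_EFin !powRM ?mulr_ge0 ?powR_ge0// -!powRrM.
    by rewrite mulfV ?gt_eqF// !powRr1// mulrA.
  apply: ge0_lee_poweR => //; first by apply: nneseries_ge0 => k _ _; exact: poweR_ge0.
  apply: nneseries_le_partial => [k|N]; first exact: poweR_ge0.
  pose e : R := (N.+2%:R^-1)%R.
  have e01 : (0 < e < 1)%R by rewrite invr_gt0 ltr0n/= invf_lt1 ?ltr0n// ltr1n.
  have ae : (0 <= a + e)%R by case/andP: e01; lra.
  pose v k := ((2^-1 ^+ k.+1) `^ (a + e))%:E * dyadic u k.
  apply: (@le_trans _ _ (\sum_(0 <= k < N) (32 `^ tau)%:E * v k.+1 `^ tau)).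
    rewrite big_nat [leRHS]big_nat; apply: lee_sum => k /andP[_ kN].
    have v0 : 0 <= v k.+1 by rewrite mule_ge0 ?dyadic_ge0// lee_fin powR_ge0.
    rewrite -(poweR_EFin 32) -poweRM ?lee_fin//.
    apply: ge0_lee_poweR; first exact: ltW.
      by rewrite mule_ge0 ?dyadic_ge0// lee_fin powR_ge0.
    rewrite /v muleA -EFinM; apply: lee_wpmul2r; first exact: dyadic_ge0.
    rewrite lee_fin.
    have h1 : ((2^-1 ^+ k) `^ a <= 2 * (2^-1 ^+ k) `^ (a + e) :> R)%R.
      apply: half_powR_perturb; rewrite /e mulrC ler_pdivrMr ?ltr0n// mul1r ler_nat.
      by rewrite ltnW// ltnW// ltnW.
    have h2 : ((2^-1 ^+ k) `^ (a + e) <= 2 ^+ 4 * (2^-1 ^+ k.+2) `^ (a + e) :> R)%R.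
      have := @half_powR_shift R (a + e) k 2 4; rewrite addn2; apply => //.
      by case/andP: e01; lra.
    apply: (le_trans h1).
    have -> : (32 = 2 * 2 ^+ 4 :> R)%R by ring.
    by rewrite -mulrA ler_pM2l.
  rewrite -ge0_sume_distrr; last by move=> k _; exact: poweR_ge0.
  apply: lee_wpmul2l; first by rewrite lee_fin powR_ge0.
  apply: (@le_trans _ _ (\sum_(0 <= k < N.+1) v k `^ tau)).
    rewrite [leRHS]big_nat_recl//; apply: lee_paddl; first exact: poweR_ge0.
    exact: lexx.
  apply: (@le_trans _ _ (\sum_(k <oo) v k `^ tau)).
    by apply: nneseries_lim_ge => k _ _; exact: poweR_ge0.
  apply: (le_trans (dyadic_le_lorentz _ _ ae tau0)).
  rewrite EFinM; apply: lee_wpmul2l; first by rewrite lee_fin.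
  rewrite -(poweR_EFin X); apply: ge0_lee_poweR; [exact: ltW|exact: lorentz_qnorm_ge0|].
  exact: uX.
exists 2%R => // u a X /andP[a0 a1] X0 uX.
apply: ge_ereal_sup => _ [t t01 <-].
have := t01; rewrite /= in_itv/= => t01'; have [k kt] := dyadic_itvP t01'.
pose e : R := (k.+2%:R^-1)%R.
have e01 : (0 < e < 1)%R by rewrite invr_gt0 ltr0n/= invf_lt1 ?ltr0n// ltr1n.
have /andP[t0 t1] := t01'.
have ht : (t `^ a <= 2 * t `^ (a + e))%R.
  rewrite powRD; last by rewrite (gt_eqF t0) implybT.
  rewrite mulrCA -[leLHS]mulr1; apply: ler_wpM2l; first exact: powR_ge0.
  have := @half_powR_perturb R 0 e k.+1; rewrite powRr0 add0r => h.
  have : ((2^-1 ^+ k.+1) `^ e <= t `^ e)%R.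
    apply: ge0_ler_powR; rewrite ?nnegrE ?(ltW (half_exp_gt0 _)) ?(ltW t0)//.
      by case/andP: e01 => /ltW.
    by move: kt; rewrite /dyadic_itv/= in_itv/= => /andP[].
  suff : (e * k.+1%:R <= 1)%R by move/h; lra.
  by rewrite /e mulrC ler_pdivrMr ?ltr0n// mul1r ler_nat.
apply: (@le_trans _ _ (2%:E * ((t `^ (a + e))%:E * rearrangement Omega u (t * fine (mu Omega))))).
  rewrite muleA -EFinM; apply: lee_wpmul2r; first exact: rearrangement_ge0.
  by rewrite lee_fin.
rewrite EFinM; apply: lee_wpmul2l; first by rewrite lee_fin.
apply: le_trans (uX e e01); apply: ereal_sup_ubound.
by exists t.
Qed.

End lorentz_convolution.

(** * Grand quasinorms of a nonincreasing function *)

Section grand_quasinorm.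
Context {R : realType}.
Implicit Types (theta s e z X : R) (N : R -> \bar R).

(** The passage from a Lorentz quasinorm to the grand one, for an arbitrary function
    [N] of the exponent: the arguments about the parameter [e] use [N] only
    through its monotonicity and its right limits. *)
Definition grand theta s N : \bar R :=
  if (0 <= theta)%R then
    ereal_sup [set (e `^ theta)%:E * N (s + e)%R | e in `]0%R, 1%R[]
  else ereal_inf [set (e `^ theta)%:E * N (s - e)%R | e in `]0%R, s[].

Lemma grand_ge0 theta s N : (forall a, 0 <= N a) -> 0 <= grand theta s N.
Proof.
move=> N0; rewrite /grand; case: ifP => _; last first.
  by apply: le_ereal_inf_tmp => _ [e _ <-]; rewrite mule_ge0// lee_fin powR_ge0.
apply: (@le_trans _ _ ((2^-1 `^ theta)%:E * N (s + 2^-1)%R)).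
  by rewrite mule_ge0// lee_fin powR_ge0.
apply: ereal_sup_ubound; exists 2^-1%R => //=.
by rewrite in_itv/=; apply/andP; split; lra.
Qed.

Lemma powRVK e theta : (0 < e)%R -> (e `^ (- theta) * e `^ theta = 1)%R.
Proof. by move=> e0; rewrite powRN mulVf// gt_eqF// powR_gt0. Qed.

(** Only small [e] matter: beyond [kap] the value [N (s + kap)] is an upper
    bound. *)
Lemma le_grand_pos theta s N (kap X : R) :
  (forall a a', (a <= a')%R -> N a' <= N a) -> (forall a, 0 <= N a) ->
  (0 <= theta)%R -> (0 < kap <= 1)%R -> (0 <= X)%R ->
  (forall e, (0 < e <= kap)%R -> N (s + e)%R <= (X * e `^ (- theta))%:E) ->
  grand theta s N <= (kap `^ (- theta) * X)%:E.
Proof.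
move=> Nanti N0 th0 /andP[k0 k1] X0 HX; rewrite /grand th0.
apply: ge_ereal_sup => _ [e + <-]; rewrite /= in_itv/= => /andP[e0 e1].
have [ek|ke] := leP e kap.
  apply: (@le_trans _ _ ((e `^ theta)%:E * (X * e `^ (- theta))%:E)).
    by apply: lee_wpmul2l; rewrite ?lee_fin ?powR_ge0// HX// e0.
  rewrite -EFinM lee_fin mulrCA mulrC [(_ * e `^ _)%R]mulrC powRVK// mul1r.
  rewrite ler_peMl// powRN invf_ge1 ?powR_gt0//.
  have := @ge0_ler_powR R theta th0 kap 1%R; rewrite powR1.
  by apply; rewrite ?nnegrE// ltW.
apply: (@le_trans _ _ (1 * N (s + kap)%R)).
  apply: lee_pmul; rewrite ?lee_fin ?powR_ge0//; last by apply: Nanti; lra.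
  have := @ge0_ler_powR R theta th0 e 1%R; rewrite powR1.
  by apply; rewrite ?nnegrE// ltW.
by rewrite mul1e mulrC; apply: HX; rewrite k0 lexx.
Qed.

(** For [theta = 0] the left-hand side is a supremum, not an infimum, and it is
    controlled by [N s] itself. Since [0 ^ 0 = 1], allowing [e = 0] exactly in this
    case treats it together with the others. *)
Lemma le_grand_neg theta s N e X :
  (forall a a', (a <= a')%R -> N a' <= N a) ->
  (0 <= theta)%R -> (0 <= e < s)%R -> (e = 0 -> theta = 0)%R ->
  N (s - e)%R <= (X * e `^ theta)%:E -> grand (- theta)%R s N <= X%:E.
Proof.
move=> Nanti th0 /andP[e0 es] eth NX.
have [theta0|thN0] := eqVneq theta 0%R.
  move: NX; rewrite theta0 oppr0 powRr0 mulr1 => NX; rewrite /grand lexx.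
  apply: ge_ereal_sup => _ [e' + <-]; rewrite /= in_itv/= => /andP[e'0 e'1].
  by rewrite powRr0 mul1e; apply: le_trans NX; apply: Nanti; lra.
have th : (0 < theta)%R by rewrite lt_neqAle eq_sym thN0.
have {}e0 : (0 < e)%R.
  by rewrite lt_neqAle e0 andbT eq_sym; apply/negP => /eqP/eth/eqP; rewrite (negPf thN0).
rewrite /grand oppr_ge0 [(theta <= 0)%R]leNgt th/=.
apply: (@le_trans _ _ ((e `^ (- theta))%:E * N (s - e)%R)).
  by apply: ereal_inf_lbound; exists e => //=; rewrite in_itv/= e0.
apply: (@le_trans _ _ ((e `^ (- theta))%:E * (X * e `^ theta)%:E)).
  by apply: lee_wpmul2l => //; rewrite lee_fin powR_ge0.
by rewrite -EFinM lee_fin mulrCA powRVK// mulr1.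
Qed.

(** What is left of right continuity for the Lorentz quasinorms when the limit is
    only compared up to a constant (lorentz_right_limit). *)
Definition right_limit_bounded (C0 s : R) N := forall X : R, (0 <= X)%R ->
  (forall e, (0 < e < 1)%R -> N (s + e)%R <= X%:E) -> N s <= (C0 * X)%:E.

Lemma grand_pos_ge_gt0 theta s N (e z : R) :
  (0 <= theta)%R -> (0 < e < 1)%R ->
  grand theta s N <= z%:E -> N (s + e)%R <= (z * e `^ (- theta))%:E.
Proof.
move=> th0 e01 Hz; have /andP[e0 e1] := e01.
have : (e `^ theta)%:E * N (s + e)%R <= z%:E.
  apply: le_trans Hz; rewrite /grand th0.
  by apply: ereal_sup_ubound; exists e => //=; rewrite in_itv.
rewrite -lee_pdivlMl ?powR_gt0// => /le_trans; apply.
by rewrite -EFinM lee_fin powRN mulrC.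
Qed.

Lemma grand_pos_ge theta s N (C0 e z : R) : (0 <= C0)%R ->
  right_limit_bounded C0 s N ->
  (0 <= theta)%R -> (0 <= e < 1)%R -> (e = 0 -> theta = 0)%R -> (0 <= z)%R ->
  grand theta s N <= z%:E -> N (s + e)%R <= ((1 + C0) * z * e `^ (- theta))%:E.
Proof.
move=> C00 Nlim th0 /andP[e0 e1] eth z0 Hz.
have H e' (e'01 : (0 < e' < 1)%R) := grand_pos_ge_gt0 th0 e'01 Hz.
have [e00|eN0] := eqVneq e 0%R.
  move: H; rewrite e00 (eth e00) oppr0 powRr0 mulr1 addr0 => H.
  have h := Nlim z z0; apply: le_trans (h _) _.
    by move=> e' /H; rewrite powRr0 mulr1.
  by rewrite lee_fin ler_wpM2r// lerDr.
have {}e0 : (0 < e)%R by rewrite lt_neqAle eq_sym eN0.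
apply: le_trans (H e _) _; first by rewrite e0.
by rewrite lee_fin -mulrA ler_peMl ?mulr_ge0 ?powR_ge0// lerDl.
Qed.

(** An almost minimal [e] can be taken in [0, kap]: if it exceeds [kap], then [kap]
    is as good up to the factor [(s / kap) ^ theta]. For [theta = 0], where the
    quasinorm is a supremum, [e = 0] is taken. *)
Lemma grand_neg_ge theta s N (C0 kap z : R) : (0 <= C0)%R ->
  (forall a a', (a <= a')%R -> N a' <= N a) -> (forall a, 0 <= N a) ->
  right_limit_bounded C0 s N ->
  (0 <= theta)%R -> (0 < kap < s)%R -> (0 <= z)%R ->
  grand (- theta)%R s N < z%:E ->
  exists e, [/\ (0 <= e <= kap)%R, (e = 0 -> theta = 0)%R &
    N (s - e)%R <= (((s / kap) `^ theta + C0) * z * e `^ theta)%:E].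
Proof.
move=> C00 Nanti N0 Nlim th0 /andP[k0 ks] z0.
have s0 : (0 < s)%R by exact: lt_trans ks.
have [theta0|thN0] := eqVneq theta 0%R.
  rewrite theta0 oppr0 /grand lexx powRr0 => Hz; exists 0%R; split => //.
    by rewrite lexx ltW.
  rewrite subr0 powRr0 mulr1; apply: le_trans (Nlim z z0 _) _.
    move=> e /andP[e0 e1]; apply: le_trans (ltW Hz); apply: ereal_sup_ubound.
    by exists e; rewrite /= ?in_itv/= ?e0// powRr0 mul1e.
  by rewrite lee_fin ler_wpM2r// lerDr.
have th : (0 < theta)%R by rewrite lt_neqAle eq_sym thN0.
rewrite /grand oppr_ge0 [(theta <= 0)%R]leNgt th/= => /ereal_inf_lt[_ [e + <-]].
rewrite /= in_itv/= => /andP[e0 es] Hz.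
have C1 : (1 <= (s / kap) `^ theta + C0)%R.
  apply: ler_wpDr => //.
  have := @ge0_ler_powR R theta th0 1%R (s / kap)%R; rewrite powR1; apply.
  - by rewrite nnegrE.
  - by rewrite nnegrE divr_ge0// ltW.
  - by rewrite ler_pdivlMr// mul1r ltW.
have Ne : N (s - e)%R <= (z * e `^ theta)%:E.
  move: (ltW Hz); rewrite -lee_pdivlMl ?powR_gt0// => /le_trans; apply.
  by rewrite -EFinM lee_fin powRN invrK mulrC.
have [ek|ke] := leP e kap.
  exists e; split; [by rewrite ltW| by move=> e00; move: e0; rewrite e00 ltxx|].
  apply: (le_trans Ne); rewrite lee_fin -mulrA.
  by rewrite ler_peMl// mulr_ge0// powR_ge0.
exists kap; split; [by rewrite lexx ltW|by move=> k00; move: k0; rewrite k00 ltxx|].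
apply: (@le_trans _ _ (N (s - e)%R)); first by apply: Nanti; lra.
apply: (le_trans Ne); rewrite lee_fin mulrAC -[leRHS]mulrC.
apply: ler_wpM2l => //; rewrite mulrDl -powRM ?divr_ge0 ?(ltW s0) ?(ltW k0)//.
rewrite divfK ?gt_eqF//; apply: ler_wpDr; first by rewrite mulr_ge0// powR_ge0.
by apply: ge0_ler_powR; rewrite ?nnegrE// ltW.
Qed.

(** Infima are only approached, so the estimates are first obtained for numbers
    above the two quasinorms. *)
Lemma lee_mul_approx (H : \bar R) (C a b : R) : (0 <= C)%R -> (0 <= a)%R -> (0 <= b)%R ->
  (forall x y, (a < x)%R -> (b < y)%R -> H <= (C * (x * y))%:E) ->
  H <= (C * (a * b))%:E.
Proof.
move=> C0 a0 b0 HH; apply/lee_addgt0Pr => e e0.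
pose D := (C * (a + b + 1) + 1)%R.
have D0 : (0 < D)%R by rewrite ltr_wpDl// mulr_ge0// !addr_ge0.
pose d := Num.min 1%R (e / D)%R.
have d0 : (0 < d)%R by rewrite lt_min ltr01 divr_gt0.
have d1 : (d <= 1)%R by rewrite ge_min lexx.
have dD : (d * D <= e)%R by rewrite -ler_pdivlMr// ge_min lexx orbT.
apply: (le_trans (HH (a + d) (b + d) _ _)%R); rewrite ?ltrDl//.
rewrite -EFinD lee_fin.
have dd : (C * (d * d) <= C * d)%R by rewrite ler_wpM2l// ler_piMl// ltW.
by move: dD; rewrite /D; lra.
Qed.

End grand_quasinorm.

(** * Distribution of the shifts *)

Section grand_convolution.
Context {R : realType}.
Variables (sp sq sr kap C0 C : R) (Nf Ng Nh : R -> \bar R).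
Hypotheses (kap0 : (0 < kap)%R) (kap1 : (2 * kap < 1)%R).
Hypotheses (kap_sp : (kap < sp)%R) (kap_sr : (kap < sr)%R) (kap_sq : (2 * kap < sq)%R).
Hypotheses (C00 : (0 <= C0)%R) (C_gt0 : (0 < C)%R).
Hypothesis Nf_anti : forall a a', (a <= a')%R -> Nf a' <= Nf a.
Hypothesis Ng_anti : forall a a', (a <= a')%R -> Ng a' <= Ng a.
Hypothesis Nh_anti : forall a a', (a <= a')%R -> Nh a' <= Nh a.
Hypothesis Nf_ge0 : forall a, 0 <= Nf a.
Hypothesis Ng_ge0 : forall a, 0 <= Ng a.
Hypothesis Nh_ge0 : forall a, 0 <= Nh a.
Hypothesis Nf_lim : right_limit_bounded C0 sp Nf.
Hypothesis Ng_lim : right_limit_bounded C0 sr Ng.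
Hypothesis young : forall d e x y : R,
  (- (2 * kap) <= d <= 2 * kap)%R -> (- (2 * kap) <= e <= 2 * kap)%R ->
  (0 < y)%R -> Nf (sp + d)%R <= x%:E -> Ng (sr + e)%R <= y%:E ->
  Nh (sq + (d + e))%R <= (C * (x * y))%:E.

Variables (theta theta0 theta1 : R) (zf zg : R).
Hypotheses (th_ge0 : (0 <= theta)%R) (th0_ge0 : (0 <= theta0)%R).
Hypotheses (th1_ge0 : (0 <= theta1)%R) (zf0 : (0 < zf)%R) (zg0 : (0 < zg)%R).

Let pw_gt0 (e t : R) : (0 <= e)%R -> (e = 0 -> t = 0)%R -> (0 < e `^ t)%R.
Proof.
move=> e0 et; have [e00|eN0] := eqVneq e 0%R; first by rewrite (et e00) powRr0.
by rewrite powR_gt0// lt_neqAle eq_sym eN0.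
Qed.

Let powR_le (x y t : R) : (0 <= t)%R -> (0 <= x)%R -> (x <= y)%R -> (x `^ t <= y `^ t)%R.
Proof.
move=> t0 x0 xy; apply: ge0_ler_powR => //; rewrite nnegrE//.
exact: le_trans xy.
Qed.

Definition neg_constant (t s : R) : R := ((s / kap) `^ t + C0)%R.

Lemma neg_constant_gt0 t s : (0 < s)%R -> (0 < neg_constant t s)%R.
Proof. by move=> s0; rewrite ltr_wpDr//; apply: powR_gt0; exact: divr_gt0. Qed.

Let sp0 : (0 < sp)%R. Proof. exact: lt_trans kap_sp. Qed.
Let sr0 : (0 < sr)%R. Proof. exact: lt_trans kap_sr. Qed.
Let kap_sp' : (0 < kap < sp)%R. Proof. by rewrite kap0. Qed.
Let kap_sr' : (0 < kap < sr)%R. Proof. by rewrite kap0. Qed.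

(** The exponents of [f], [g] and the convolution are shifted by [-d], [d + e]
    and [e]; the loss [(d + e) ^ (- theta)] is shared between [f] and the
    convolution. *)
Lemma grand_young_neg_pos : theta = (theta1 + theta0)%R ->
  grand (- theta0)%R sp Nf < zf%:E -> grand theta sr Ng < zg%:E ->
  grand theta1 sq Nh <=
    (kap `^ (- theta1) * (C * neg_constant theta0 sp) * (zf * zg))%:E.
Proof.
have k0 := kap0; have k1 := kap1; have k2 := kap_sq.
have h0 := th0_ge0; have h1 := th1_ge0; have h := th_ge0.
move=> thE fz gz.
have C1 := neg_constant_gt0 theta0 sp0.
have [d [/andP[d0 dk] dth Hf]] :=
    grand_neg_ge C00 Nf_anti Nf_ge0 Nf_lim th0_ge0 kap_sp' (ltW zf0) fz.
rewrite -mulrA; apply: le_grand_pos => //.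
- by rewrite kap0/=; lra.
- by rewrite !mulr_ge0// ltW.
move=> e /andP[e0 ek].
have Hg : Ng (sr + (d + e))%R <= (zg * (d + e) `^ (- theta))%:E.
  by apply: grand_pos_ge_gt0 => //; [apply/andP; split; lra|exact: ltW].
have de0 : (0 < d + e)%R by lra.
have := young (d := - d) _ _ _ Hf Hg.
rewrite addKr => hy; apply: (le_trans (hy _ _ _)).
- by apply/andP; split; lra.
- by apply/andP; split; lra.
- by rewrite mulr_gt0// powR_gt0.
rewrite lee_fin.
have key : (d `^ theta0 * (d + e) `^ (- theta) <= e `^ (- theta1))%R.
  rewrite thE opprD powRD; last by rewrite (gt_eqF de0) implybT.
  rewrite mulrCA -[leRHS]mulr1; apply: ler_pM; rewrite ?powR_ge0 ?mulr_ge0 ?powR_ge0//.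
    rewrite !powRN lef_pV2 ?posrE ?powR_gt0//; apply: powR_le => //; lra.
  rewrite powRN ler_pdivrMr ?powR_gt0// mul1r; apply: powR_le => //; lra.
rewrite (_ : (C * _ = C * neg_constant theta0 sp * (zf * zg) *
    (d `^ theta0 * (d + e) `^ (- theta)))%R); last by rewrite /neg_constant; ring.
by apply: ler_wpM2l => //; rewrite !mulr_ge0// ltW.
Qed.

(** Here [g] supplies a shift [-e], half of which is returned to [f]: the
    convolution is estimated at [sq - e / 2]. *)
Lemma grand_young_pos_neg : theta = (theta1 + theta0)%R ->
  grand theta0 sp Nf < zf%:E -> grand (- theta)%R sr Ng < zg%:E ->
  grand (- theta1)%R sq Nh <=
    (C * (1 + C0) * neg_constant theta sr * 2 `^ theta * (zf * zg))%:E.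
Proof.
have k0 := kap0; have k1 := kap1; have k2 := kap_sq.
have h0 := th0_ge0; have h1 := th1_ge0; have h := th_ge0.
move=> thE fz gz.
have C1 := neg_constant_gt0 theta sr0.
have [e [/andP[e0 ek] eth Hg]] :=
    grand_neg_ge C00 Ng_anti Ng_ge0 Ng_lim th_ge0 kap_sr' (ltW zg0) gz.
have ez : (e / 2 = 0 -> e = 0)%R by lra.
have th00 : (e = 0 -> theta0 = 0)%R by move/eth; lra.
have th10 : (e = 0 -> theta1 = 0)%R by move/eth; lra.
have Hf := grand_pos_ge (e := (e / 2)%R) C00 Nf_lim th0_ge0 _ _ (ltW zf0) (ltW fz).
have {}Hf := Hf _ (fun h => th00 (ez h)).
apply: (@le_grand_neg _ theta1 sq Nh (e / 2)%R) => //.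
- by apply/andP; split; lra.
- by move=> /ez /th10.
have := young (d := (e / 2)%R) _ _ _ (Hf _) Hg.
rewrite (_ : (sq + (e / 2 + - e) = sq - e / 2)%R); last by lra.
move=> hy; apply: (le_trans (hy _ _ _ _)).
- by apply/andP; split; lra.
- by apply/andP; split; lra.
- by rewrite !mulr_gt0//; exact: pw_gt0.
- by apply/andP; split; lra.
rewrite lee_fin.
have key : ((e / 2) `^ (- theta0) * e `^ theta = 2 `^ theta * (e / 2) `^ theta1)%R.
  have [e00|eN0] := eqVneq e 0%R.
    by rewrite (eth e00) (th00 e00) (th10 e00) oppr0 !powRr0.
  have e20 : (e / 2 != 0)%R by apply: contra_neq eN0 => /ez.
  have eE : (e = 2 * (e / 2))%R by lra.
  have E0 : (0 <= e / 2)%R by lra.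
  move: eE E0 e20; move: (e / 2)%R => E eE E0 E20.
  rewrite eE powRM// mulrCA -powRD ?E20 ?implybT//.
  by congr (_ * _ `^ _)%R; lra.
rewrite (_ : (C * _ = C * (1 + C0) * neg_constant theta sr * (zf * zg) *
    ((e / 2) `^ (- theta0) * e `^ theta))%R); last by rewrite /neg_constant; ring.
by rewrite key le_eqVlt; apply/orP; left; apply/eqP; ring.
Qed.

(** The shift [e] of the convolution is divided equally between [f] and [g]. *)
Lemma grand_young_pos_pos : theta1 = (theta + theta0)%R ->
  grand theta0 sp Nf < zf%:E -> grand theta sr Ng < zg%:E ->
  grand theta1 sq Nh <= (kap `^ (- theta1) * (C * 2 `^ theta1) * (zf * zg))%:E.
Proof.
have k0 := kap0; have k1 := kap1; have k2 := kap_sq.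
have h0 := th0_ge0; have h1 := th1_ge0; have h := th_ge0.
move=> thE fz gz; rewrite -mulrA; apply: le_grand_pos => //.
- by rewrite kap0/=; lra.
- by rewrite !mulr_ge0 ?powR_ge0// ltW.
move=> e /andP[e0 ek].
have e01 : (0 < e / 2 < 1)%R by apply/andP; split; lra.
have Hf := grand_pos_ge_gt0 th0_ge0 e01 (ltW fz).
have Hg := grand_pos_ge_gt0 th_ge0 e01 (ltW gz).
have := young _ _ _ Hf Hg.
rewrite (_ : (e / 2 + e / 2 = e)%R); last by lra.
move=> hy; apply: (le_trans (hy _ _ _)).
- by apply/andP; split; lra.
- by apply/andP; split; lra.
- by rewrite mulr_gt0// powR_gt0//; case/andP: e01.
rewrite lee_fin.
have key : ((e / 2) `^ (- theta0) * (e / 2) `^ (- theta) = 2 `^ theta1 * e `^ (- theta1))%R.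
  have e20 : (e / 2 != 0)%R by case/andP: e01 => /gt_eqF ->.
  rewrite -powRD ?e20 ?implybT// -opprD addrC -thE powRM ?(ltW e0) ?invr_ge0//.
  rewrite [LHS]mulrC; congr (_ * _)%R.
  by rewrite -powR_inv1// -powRrM mulN1r opprK.
rewrite (_ : (C * _ = C * (zf * zg) *
    ((e / 2) `^ (- theta0) * (e / 2) `^ (- theta)))%R); last by ring.
by rewrite key le_eqVlt; apply/orP; left; apply/eqP; ring.
Qed.

(** The shifts [-d] and [-e] of [f] and [g] add up, and [d] and [e] are both at
    most [d + e]. *)
Lemma grand_young_neg_neg : theta1 = (theta + theta0)%R ->
  grand (- theta0)%R sp Nf < zf%:E -> grand (- theta)%R sr Ng < zg%:E ->
  grand (- theta1)%R sq Nh <=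
    (C * neg_constant theta0 sp * neg_constant theta sr * (zf * zg))%:E.
Proof.
have k0 := kap0; have k1 := kap1; have k2 := kap_sq.
have h0 := th0_ge0; have h1 := th1_ge0; have h := th_ge0.
move=> thE fz gz.
have C1 := neg_constant_gt0 theta0 sp0; have C2 := neg_constant_gt0 theta sr0.
have [d [/andP[d0 dk] dth Hf]] :=
    grand_neg_ge C00 Nf_anti Nf_ge0 Nf_lim th0_ge0 kap_sp' (ltW zf0) fz.
have [e [/andP[e0 ek] eth Hg]] :=
    grand_neg_ge C00 Ng_anti Ng_ge0 Ng_lim th_ge0 kap_sr' (ltW zg0) gz.
apply: (@le_grand_neg _ theta1 sq Nh (d + e)%R) => //.
- by apply/andP; split; lra.
- move=> de0; have d00 : d = 0%R by lra.
  have e00 : e = 0%R by lra.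
  by rewrite thE (dth d00) (eth e00) addr0.
have := young (d := (- d)%R) _ _ _ Hf Hg; rewrite -opprD.
move=> hy; apply: (le_trans (hy _ _ _)).
- by apply/andP; split; lra.
- by apply/andP; split; lra.
- by rewrite !mulr_gt0//; exact: pw_gt0.
rewrite lee_fin.
have key : (d `^ theta0 * e `^ theta <= (d + e) `^ theta1)%R.
  apply: (@le_trans _ _ ((d + e) `^ theta0 * (d + e) `^ theta)%R).
    apply: ler_pM; rewrite ?powR_ge0//; apply: powR_le => //; lra.
  have [de0|deN0] := eqVneq (d + e)%R 0%R.
    have d00 : d = 0%R by lra.
    have e00 : e = 0%R by lra.
    by rewrite thE (dth d00) (eth e00) addr0 powRr0 mulr1.
  by rewrite thE -powRD ?deN0 ?implybT// [(theta0 + _)%R]addrC.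
rewrite (_ : (C * _ = C * neg_constant theta0 sp * neg_constant theta sr * (zf * zg) *
    (d `^ theta0 * e `^ theta))%R); last by rewrite /neg_constant; ring.
by apply: ler_wpM2l => //; rewrite !mulr_ge0// ltW.
Qed.

End grand_convolution.

(** * Convolution in grand Lorentz spaces *)

Lemma GL_normE (R : realType) (n : nat) (Omega : set (Rn R n)) (theta p : R)
    (q : \bar R) (f : Rn R n -> \bar R) :
  GL_norm Omega theta p q f =
  grand theta p^-1 (fun a => lorentz_qnorm Omega a q f).
Proof. by []. Qed.

Lemma right_limit_bounded_le (R : realType) (C C' s : R) (N : R -> \bar R) :
  (C <= C')%R -> right_limit_bounded C s N -> right_limit_bounded C' s N.
Proof.
move=> CC' H X X0 HX; apply: (le_trans (H X X0 HX)).
by rewrite lee_fin ler_wpM2r.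
Qed.

Lemma GL_norm_mul_le (R : realType) (n : nat) (Omega : set (Rn R n))
    (t t' p r C : R) (tau : \bar R) (f g : Rn R n -> \bar R) (H : \bar R) :
  (0 <= C)%R ->
  grand_lorentz Omega t p tau f -> grand_lorentz Omega t' r +oo g ->
  (forall x y : R, (0 < x)%R -> (0 < y)%R ->
    GL_norm Omega t p tau f < x%:E -> GL_norm Omega t' r +oo g < y%:E ->
    H <= (C * (x * y))%:E) ->
  H <= C%:E * (GL_norm Omega t p tau f * GL_norm Omega t' r +oo g).
Proof.
move=> C0 [_ foo] [_ goo] HH.
have f0 : 0 <= GL_norm Omega t p tau f.
  by rewrite GL_normE; apply: grand_ge0 => a; exact: lorentz_qnorm_ge0.
have g0 : 0 <= GL_norm Omega t' r +oo g.
  by rewrite GL_normE; apply: grand_ge0 => a; exact: lorentz_qnorm_ge0.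
have fE : GL_norm Omega t p tau f = (fine (GL_norm Omega t p tau f))%:E.
  by rewrite fineK// ge0_fin_numE.
have gE : GL_norm Omega t' r +oo g = (fine (GL_norm Omega t' r +oo g))%:E.
  by rewrite fineK// ge0_fin_numE.
rewrite fE gE -!EFinM; apply: lee_mul_approx; [exact: C0|exact: fine_ge0|exact: fine_ge0|].
move=> x y fx gy; apply: HH.
- by apply: le_lt_trans fx; exact: fine_ge0.
- by apply: le_lt_trans gy; exact: fine_ge0.
- by rewrite fE lte_fin.
- by rewrite gE lte_fin.
Qed.

Theorem theorem3p2 (R : realType) (n : nat) (Omega : set (Rn R n))
    (mOmega : measurable Omega) (Omega_fin : lebesgue_Rn Omega < +oo)
    (p q r theta theta0 theta1 : R) (tau : \bar R)
    (p_gt1 : (1 < p)%R) (p_lt_q : (p < q)%R)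
    (theta_ge0 : (0 <= theta)%R) (theta0_ge0 : (0 <= theta0)%R)
    (theta1_ge0 : (0 <= theta1)%R)
    (r_def : (r^-1 = 1 + q^-1 - p^-1)%R) (tau_gt0 : 0 < tau) :
  ((theta = theta1 + theta0)%R ->
    (exists2 C : R, (0 < C)%R & forall f g : Rn R n -> \bar R,
      grand_lorentz Omega (- theta0)%R p tau f ->
      grand_lorentz Omega theta r +oo g ->
      GL_norm Omega theta1 q tau (convolution Omega f g) <=
        C%:E * (GL_norm Omega (- theta0)%R p tau f *
                GL_norm Omega theta r +oo g)) /\
    (exists2 C : R, (0 < C)%R & forall f g : Rn R n -> \bar R,
      grand_lorentz Omega theta0 p tau f ->
      grand_lorentz Omega (- theta)%R r +oo g ->
      GL_norm Omega (- theta1)%R q tau (convolution Omega f g) <=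
        C%:E * (GL_norm Omega theta0 p tau f *
                GL_norm Omega (- theta)%R r +oo g))) /\
  ((theta = theta1 - theta0)%R ->
    (exists2 C : R, (0 < C)%R & forall f g : Rn R n -> \bar R,
      grand_lorentz Omega theta0 p tau f ->
      grand_lorentz Omega theta r +oo g ->
      GL_norm Omega theta1 q tau (convolution Omega f g) <=
        C%:E * (GL_norm Omega theta0 p tau f *
                GL_norm Omega theta r +oo g)) /\
    (exists2 C : R, (0 < C)%R & forall f g : Rn R n -> \bar R,
      grand_lorentz Omega (- theta0)%R p tau f ->
      grand_lorentz Omega (- theta)%R r +oo g ->
      GL_norm Omega (- theta1)%R q tau (convolution Omega f g) <=
        C%:E * (GL_norm Omega (- theta0)%R p tau f *
                GL_norm Omega (- theta)%R r +oo g))).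
Proof.
have q0 : (0 < q^-1)%R by rewrite invr_gt0; lra.
have qp : (q^-1 < p^-1)%R by rewrite ltf_pV2 ?posrE; lra.
have p1 : (p^-1 < 1)%R by rewrite invf_lt1; lra.
have [m m0 [mq mp mr]] : exists2 m : R, (0 < m)%R &
    [/\ m <= q^-1, m <= 1 - p^-1 & m <= p^-1 - q^-1]%R.
  exists (Num.min q^-1 (Num.min (1 - p^-1) (p^-1 - q^-1)))%R.
    by rewrite !lt_min q0 !subr_gt0 p1 qp.
  by split; rewrite !ge_min lexx ?orbT.
(* the exponents [p^-1] and [r^-1] are shifted by at most [2 * kap] each; one
   eighth of the distances leaves [p^-1 + 2 * kap <= 1 - kap] and
   [kap <= q^-1 - 4 * kap] *)
pose kap := (m / 8)%R.
have kE : (m = 8 * kap)%R by rewrite /kap; lra.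
have kap0 : (0 < kap)%R by rewrite /kap; lra.
have b1 : (r^-1 + 2 * kap < 1)%R by rewrite r_def; lra.
have [C C_gt0 HC] := lorentz_convolution_le mOmega Omega_fin kap0 b1 tau_gt0.
have [Cf Cf0 Hf] := lorentz_right_limit Omega tau_gt0.
have [Cg Cg0 Hg] := lorentz_right_limit Omega (@ltry R 0).
pose C0 := (Cf + Cg)%R.
have C00 : (0 <= C0)%R by rewrite addr_ge0// ltW.
have limf f : right_limit_bounded C0 p^-1 (fun a => lorentz_qnorm Omega a tau f).
  apply: (@right_limit_bounded_le _ Cf); first by rewrite lerDl ltW.
  by move=> X X0; apply: Hf => //; apply/andP; split; lra.
have limg g : right_limit_bounded C0 r^-1 (fun a => lorentz_qnorm Omega a +oo g).
  apply: (@right_limit_bounded_le _ Cg); first by rewrite lerDr ltW.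
  by move=> X X0; apply: Hg => //; rewrite r_def; apply/andP; split; lra.
have anti t (t0 : 0 < t) u (a a' : R) : (a <= a')%R ->
    lorentz_qnorm Omega a' t u <= lorentz_qnorm Omega a t u by exact: lorentz_anti.
have ge0 t u (a : R) : 0 <= lorentz_qnorm Omega a t u by exact: lorentz_qnorm_ge0.
have young f g (mf : measurable_fun Omega f) (mg : measurable_fun Omega g)
    (d e x y : R) : (- (2 * kap) <= d <= 2 * kap)%R ->
    (- (2 * kap) <= e <= 2 * kap)%R -> (0 < y)%R ->
    lorentz_qnorm Omega (p^-1 + d) tau f <= x%:E ->
    lorentz_qnorm Omega (r^-1 + e) +oo g <= y%:E ->
    lorentz_qnorm Omega (q^-1 + (d + e)) tau (convolution Omega f g) <=
      (C * (x * y))%:E.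
  move=> /andP[d1 d2] /andP[e1 e2] y0 fx gy.
  rewrite (_ : (q^-1 + (d + e) = (p^-1 + d) + (r^-1 + e) - 1)%R); last by rewrite r_def; lra.
  apply: (le_trans (HC f g y _ _ mf mg y0 _ _ _ gy)).
  - by lra.
  - by rewrite lerD2l.
  - by rewrite r_def; lra.
  rewrite (_ : (C * (x * y))%:E = (C * y)%:E * x%:E); last by rewrite -EFinM; congr _%:E; ring.
  by apply: lee_wpmul2l => //; rewrite lee_fin mulr_ge0// ltW.
have k1 : (2 * kap < 1)%R by lra.
have kp : (kap < p^-1)%R by lra.
have kr : (kap < r^-1)%R by rewrite r_def; lra.
have kq : (2 * kap < q^-1)%R by lra.
have cf0 t : (0 < neg_constant kap C0 t p^-1)%R by apply: neg_constant_gt0 => //; lra.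
have cg0 t : (0 < neg_constant kap C0 t r^-1)%R.
  by apply: neg_constant_gt0 => //; exact: lt_trans kr.
have pwk (t : R) : (0 < kap `^ t)%R by exact: powR_gt0.
have pw2 (t : R) : (0 < 2 `^ t :> R)%R by exact: powR_gt0.
have C01 : (0 < 1 + C0)%R by rewrite ltr_wpDr.
have af f (a a' : R) : (a <= a')%R -> _ := anti tau tau_gt0 f a a'.
have ag g (a a' : R) : (a <= a')%R -> _ := anti +oo (ltry 0) g a a'.
pose N t u : R -> \bar R := fun a => lorentz_qnorm Omega a t u.
have thE' : theta = (theta1 - theta0)%R -> theta1 = (theta + theta0)%R.
  by move=> ->; rewrite subrK.
split=> thE; split.
- exists (kap `^ (- theta1) * (C * neg_constant kap C0 theta0 p^-1))%R.
    by rewrite !mulr_gt0.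
  move=> f g Ff Gg; apply: (GL_norm_mul_le _ Ff Gg) => [|x y x0 y0 fx gy].
    by rewrite ltW// !mulr_gt0.
  exact: (grand_young_neg_pos (Nf := N tau f) (Ng := N +oo g)
    (Nh := N tau (convolution Omega f g)) kap0 k1 kp kq C00 C_gt0 (af f) (af _) (ge0 tau f)
    (ge0 tau _) (limf f) (young f g Ff.1 Gg.1) theta_ge0 theta0_ge0 theta1_ge0
    x0 y0 thE fx gy).
- exists (C * (1 + C0) * neg_constant kap C0 theta r^-1 * 2 `^ theta)%R.
    by rewrite !mulr_gt0.
  move=> f g Ff Gg; apply: (GL_norm_mul_le _ Ff Gg) => [|x y x0 y0 fx gy].
    by rewrite ltW// !mulr_gt0.
  exact: (grand_young_pos_neg (Nf := N tau f) (Ng := N +oo g)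
    (Nh := N tau (convolution Omega f g)) kap0 k1 kr kq C00 (ag g) (af _) (ge0 +oo g)
    (limf f) (limg g) (young f g Ff.1 Gg.1) theta_ge0 theta0_ge0 theta1_ge0
    x0 y0 thE fx gy).
- exists (kap `^ (- theta1) * (C * 2 `^ theta1))%R.
    by rewrite !mulr_gt0.
  move=> f g Ff Gg; apply: (GL_norm_mul_le _ Ff Gg) => [|x y x0 y0 fx gy].
    by rewrite ltW// !mulr_gt0.
  exact: (grand_young_pos_pos (Nf := N tau f) (Ng := N +oo g)
    (Nh := N tau (convolution Omega f g)) kap0 k1 kq C_gt0 (af _) (ge0 tau _)
    (young f g Ff.1 Gg.1) theta_ge0 theta0_ge0 theta1_ge0 x0 y0 (thE' thE) fx gy).
- exists (C * neg_constant kap C0 theta0 p^-1 * neg_constant kap C0 theta r^-1)%R.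
    by rewrite !mulr_gt0.
  move=> f g Ff Gg; apply: (GL_norm_mul_le _ Ff Gg) => [|x y x0 y0 fx gy].
    by rewrite ltW// !mulr_gt0.
  exact: (grand_young_neg_neg (Nf := N tau f) (Ng := N +oo g)
    (Nh := N tau (convolution Omega f g)) kap0 k1 kp kr kq C00 C_gt0 (af f) (ag g) (af _)
    (ge0 tau f) (ge0 +oo g) (limf f) (limg g) (young f g Ff.1 Gg.1)
    theta_ge0 theta0_ge0 theta1_ge0 x0 y0 (thE' thE) fx gy).
Qed.
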